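(* Let $\alpha_1,\alpha_2,\beta_1,\beta_2>0$, let $\{X(t):t\geq 0\}$ be the continuous-time Markov chain on $\mathbb{Z}$ with alternating rates described in the context, and let $\Lambda$ be the function in the context. Let $\{a_t:t>0\}$ be a family of positive numbers such that $a_t\to0$ and $ta_t\to+\infty$ as $t\to+\infty$. Then, for all $k\in\mathbb{Z}$, the family of laws $$\left\{P\left(\sqrt{ta_t}\,\frac{X(t)-\mathbb{E}[X(t)|X(0)=k]}{t}\in\cdot\,\Big|\,X(0)=k\right):t>0\right\}$$ on $\mathbb{R}$ satisfies the large deviation principle with speed function $v_t=\frac1{a_t}$ and good rate function $J(y):=\frac{y^2}{2\Lambda''(0)}$.
   Context: $\{X(t):t\geq 0\}$ is the continuous-time Markov chain on $\mathbb{Z}$ whose state probabilities $p_{k,n}(t):=P(X(t)=n|X(0)=k)$ satisfy $p_{k,n}(0)=1_{\{k=n\}}$ and whose generator $g_{k,n}:=\lim_{t\to 0}\frac{p_{k,n}(t)-p_{k,n}(0)}{t}$ is as follows. For even $k$: $g_{k,k+1}=\alpha_1$, $g_{k,k-1}=\alpha_2$, $g_{k,k}=-(\alpha_1+\alpha_2)$. For odd $k$: $g_{k,k+1}=\beta_1$, $g_{k,k-1}=\beta_2$, $g_{k,k}=-(\beta_1+\beta_2)$. All other entries are $0$. For $z>0$, $h(z):=\frac12\sqrt{(\alpha_1+\alpha_2-(\beta_1+\beta_2))^2z^2+4(\beta_1z^2+\beta_2)(\alpha_1z^2+\alpha_2)}$; for $\gamma\in\mathbb{R}$, $\Lambda(\gamma):=\frac{h(e^\gamma)}{e^\gamma}-\frac{\alpha_1+\alpha_2+\beta_1+\beta_2}{2}$.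 One has $\Lambda''(0)=\frac{4(\alpha_1\beta_1+\alpha_2\beta_2)}{\alpha_1+\alpha_2+\beta_1+\beta_2}-\frac{8(\alpha_1\beta_1-\alpha_2\beta_2)^2}{(\alpha_1+\alpha_2+\beta_1+\beta_2)^3}>0$. Large deviation principle: a family of probability measures $\{\pi_t:t>0\}$ on a topological space $\mathcal{Y}$ satisfies the large deviation principle with rate function $I$ and speed function $v_t$ if $\lim_{t\to+\infty}v_t=+\infty$, $I:\mathcal{Y}\to[0,+\infty]$ is lower semicontinuous, $\liminf_{t\to+\infty}\frac{1}{v_t}\log\pi_t(O)\geq-\inf_{y\in O}I(y)$ for all open sets $O$, and $\limsup_{t\to+\infty}\frac{1}{v_t}\log\pi_t(C)\leq-\inf_{y\in C}I(y)$ for all closed sets $C$. The rate function $I$ is good if all level sets $\{y\in\mathcal{Y}:I(y)\leq\eta\}$, $\eta\geq0$, are compact. *)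

(* Defs.v *)
From HB Require Import structures.
From mathcomp Require Import all_boot all_order all_algebra.
From mathcomp Require Import all_classical all_reals all_analysis.

Set Implicit Arguments.
Unset Strict Implicit.
Unset Printing Implicit Defensive.

Import Order.TTheory GRing.Theory Num.Theory.
Import numFieldNormedType.Exports.

Local Open Scope classical_set_scope.
Local Open Scope ring_scope.

Definition borel (Y : ptopologicalType) := g_sigma_algebraType (@open Y).

HB.instance Definition _ := isPointed.Build int 0.

HB.instance Definition _ := @isMeasurable.Build default_measure_display
  int discrete_measurable discrete_measurable0
  discrete_measurableC discrete_measurableU.

Section large_deviations.
Context {R : realType} {Y : ptopologicalType}.
Local Open Scope ereal_scope.

(* Only the values mu t with t near +oo matter. [lne 0 = -oo] and the infimum
   over the empty set is +oo. *)
Definition satisfies_LDP (mu : R -> probability (borel Y) R)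
    (v : R -> R) (I : Y -> \bar R) : Prop :=
  [/\ v t @[t --> +oo%R] --> +oo%R,
      forall y, 0 <= I y,
      lower_semicontinuous I,
      forall O : set Y, open O ->
        limf_einf (fun t => (v t)^-1%:E * lne (mu t O)) (pinfty_nbhs R)
          >= - ereal_inf (I @` O)
    & forall C : set Y, closed C ->
        limf_esup (fun t => (v t)^-1%:E * lne (mu t C)) (pinfty_nbhs R)
          <= - ereal_inf (I @` C)].

Definition good_rate_function (I : Y -> \bar R) : Prop :=
  forall eta : R, (0 <= eta)%R -> compact [set y | I y <= eta%:E].

End large_deviations.

(* A Markov chain started from an arbitrary state is given, as usual, by one
   family of random variables X t together with the family of probability
   measures [P k = P(. | X(0) = k)]. Only times t >= 0 are meaningful. *)
Section markov_chains.
Context {R : realType} {d : measure_display} {Omega : measurableType d}.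
Variables (P : int -> probability Omega R) (X : R -> {mfun Omega >-> int}).

Definition state_probability (k n : int) (t : R) : R :=
  fine (P k [set w | X t w = n]).

(* The Markov property is written multiplicatively, so that it also makes sense
   when the conditioning event "X(s) = i and X(u.1) = u.2 for all u in past"
   has probability 0. *)
Definition is_markov_chain : Prop :=
  (forall k n : int, state_probability k n 0 = (k == n)%:R) /\
  (forall (k i j : int) (s t : R) (past : seq (R * int)),
     0 <= s -> 0 <= t -> (forall u, u \in past -> 0 <= u.1 <= s) ->
     let H := [set w | X s w = i /\ forall u, u \in past -> X u.1 w = u.2] in
     P k (H `&` [set w | X (s + t) w = j]) =
       (P k H * P i [set w | X t w = j])%E).

Definition has_generator (g : int -> int -> R) : Prop :=
  forall k n : int,
    (state_probability k n t - state_probability k n 0) / t @[t --> 0^'+]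
      --> g k n.

Definition state_mean (k : int) (t : R) : R :=
  fine 'E_(P k)[fun w => (X t w)%:~R].

Definition fluctuation (a : R -> R) (k : int) (t : R) (w : Omega) : borel R :=
  Num.sqrt (t * a t) * (((X t w)%:~R - state_mean k t) / t).

Lemma measurable_fluctuation a k t :
  measurable_fun [set: Omega] (fluctuation a k t).
Proof.
move=> _ B _; rewrite setTI.
pose g (x : int) : R := Num.sqrt (t * a t) * ((x%:~R - state_mean k t) / t).
have := @measurable_funPT _ _ _ _ (X t) measurableT (g @^-1` B) I.
by rewrite setTI.
Qed.

HB.instance Definition _ a k t :=
  isMeasurableFun.Build _ _ _ _ (fluctuation a k t)
    (measurable_fluctuation a k t).

End markov_chains.

Section alternating_rates.
Context {R : realType}.
Variables (alpha1 alpha2 beta1 beta2 : R).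

Definition alternating_generator (k n : int) : R :=
  let: (up, down) :=
    if (2 %| k)%Z then (alpha1, alpha2) else (beta1, beta2) in
  if n == k + 1 then up
  else if n == k - 1 then down
  else if n == k then - (up + down)
  else 0.

Definition h (z : R) : R :=
  2^-1 * Num.sqrt ((alpha1 + alpha2 - (beta1 + beta2)) ^+ 2 * z ^+ 2
    + 4 * (beta1 * z ^+ 2 + beta2) * (alpha1 * z ^+ 2 + alpha2)).

Definition Lambda (gamma : R) : R :=
  h (expR gamma) / expR gamma - (alpha1 + alpha2 + beta1 + beta2) / 2.

Definition J (y : R) : \bar R := (y ^+ 2 / (2 * (Lambda^`(2))%classic 0))%:E.

End alternating_rates.

(* Main.v *)
(* For gamma near 0 the generator multiplies a function k |-> e^(gamma k) r, with
   r > 0 depending only on the parity of k, by Lambda(gamma): the two values of r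
   form a Perron eigenvector of a 2x2 matrix with positive off-diagonal entries.
   Hence E_k[e^(gamma (X(t) - k))] = e^(t Lambda(gamma)) up to a factor between
   1/4 and 4.  As only the derivatives at time 0 of the transition probabilities
   are given, this comes from a comparison principle for the backward equation,
   applied to truncations of the eigenfunction for the upper bound and to the
   eigenfunction itself for the lower bound.  The inequality 1 + x <= e^x at
   gamma = +-1/sqrt t bounds E_k[X(t)] - k - Lambda'(0) t by O(sqrt t), which is
   negligible on the moderate deviation scale, so a second order expansion of
   Lambda gives the limit theta^2 Lambda''(0) / 2 of the scaled log-Laplace
   transforms; Chernoff bounds and an exponential tilt conclude (Gartner-Ellis
   with a quadratic limit). *)

Require Import Defs.
From HB Require Import structures.
From mathcomp Require Import all_boot all_order all_algebra.
From mathcomp Require Import all_classical all_reals all_analysis.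
From mathcomp Require Import measurable_realfun.
From mathcomp Require Import zify ring lra.

Set Implicit Arguments.
Unset Strict Implicit.
Unset Printing Implicit Defensive.

Import Order.TTheory GRing.Theory Num.Theory.
Import numFieldNormedType.Exports.

Local Open Scope classical_set_scope.
Local Open Scope ring_scope.

(** * Comparison principle for the backward equation *)

Section right_derivatives.
Context {R : realType}.
Implicit Types (f g : R -> R) (t l T : R).

(** The lower right Dini derivative of [f] at [t] is at least [l]. A one-sided notion is used
    because expectations along the chain are not known to be differentiable in time. *)
Definition right_derivative_ge f t l :=
  forall e, 0 < e -> \forall h \near 0^'+, f t + (l - e) * h <= f (t + h).

Lemma at_right0_ball (P : R -> Prop) : (\forall h \near 0^'+, P h) ->
  exists2 e, 0 < e & forall h, 0 < h < e -> P h.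
Proof.
move=> [e /= e0 eP]; exists e => // h /andP[h0 he]; apply: eP => //=.
by rewrite sub0r normrN gtr0_norm.
Qed.

Lemma right_derivative_geD f g t l m : right_derivative_ge f t l ->
  right_derivative_ge g t m -> right_derivative_ge (f \+ g) t (l + m).
Proof.
move=> fl gm e e0; have e20 : 0 < e / 2 by rewrite divr_gt0.
near=> h.
have Hf : f t + (l - e / 2) * h <= f (t + h) by near: h; exact: fl.
have Hg : g t + (m - e / 2) * h <= g (t + h) by near: h; exact: gm.
rewrite /=; apply: le_trans (lerD Hf Hg); rewrite le_eqVlt; apply/orP; left.
by apply/eqP; field.
Unshelve. all: by end_near. Qed.

(** It is enough to differentiate a minorant of the increments. For the chain this will be the
    contribution of finitely many intermediate states. *)
Lemma right_derivative_ge_cvg f g t l :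
  (g h - f t) / h @[h --> 0^'+] --> l ->
  (\forall h \near 0^'+, g h <= f (t + h)) -> right_derivative_ge f t l.
Proof.
move=> gl gf e e0.
have /(cvgr_ge _ gl) le_g : l - e < l by rewrite ltrBlDr ltrDl.
near=> h.
have h0 : 0 < h by near: h; exact: nbhs_right_gt.
have : g h <= f (t + h) by near: h.
apply: le_trans; rewrite addrC -lerBrDr -ler_pdivlMr //.
by near: h.
Unshelve. all: by end_near. Qed.

Lemma is_derive_right_derivative_ge f t l :
  is_derive t 1 f l -> right_derivative_ge f t l.
Proof.
move=> [df <-]; apply: (@right_derivative_ge_cvg _ (fun h => f (t + h))).
  apply: cvg_dnbhs_at_right.
  rewrite (_ : (fun _ => _) = (fun h => h^-1 *: (f (h *: 1 + t) - f t))).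
    exact: df.
  by apply/funext => h; rewrite /= [in RHS]/GRing.scale /= mulrC mulr1 addrC [h + t]addrC addrC.
exact: nearW.
Qed.

Lemma right_derivative_ge_le f t l m :
  m <= l -> right_derivative_ge f t l -> right_derivative_ge f t m.
Proof.
move=> ml fl e e0; near=> h.
have h0 : 0 < h by near: h; exact: nbhs_right_gt.
have : f t + (l - e) * h <= f (t + h) by near: h; exact: fl.
by apply: le_trans; rewrite lerD2l ler_pM2r // lerD2r.
Unshelve. all: by end_near. Qed.

(** Continuous induction: the set [E] of times at which [f] stays above the line of slope [- e] from
    [f 0] contains its supremum by the left condition, and the right derivative pushes past any
    supremum below [T]. Then [e] tends to 0. *)
Lemma right_derivative_ge0_homo f T : 0 <= T ->
  (forall t, 0 <= t < T -> right_derivative_ge f t 0) ->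
  (forall t, 0 < t <= T -> forall e, 0 < e ->
     \forall h \near 0^'+, f (t - h) <= f t + e) ->
  f 0 <= f T.
Proof.
move=> T0 fr fl.
suff H e : 0 < e -> f 0 - e * T <= f T.
  have [T0'|T1] := eqVneq T 0; first by rewrite T0'.
  have TT : 0 < T by rewrite lt_def T1.
  apply/ler_addgt0Pr => e e0.
  by rewrite -lerBlDr -[X in _ - X](divfK T1); apply: H; rewrite divr_gt0.
move=> e0; pose E := [set t | 0 <= t <= T /\ f 0 - e * t <= f t].
have E0 : E 0 by split; rewrite ?lexx// mulr0 subr0.
have supE : has_sup E.
  by split; [exists 0 | exists T => t [/andP[]]].
set b := sup E.
have b0 : 0 <= b by apply: ub_le_sup => //; case: supE.
have bT : b <= T by apply: ge_sup => //; [exists 0|move=> t [/andP[]]].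
have Eb : E b.
  split; first by rewrite b0.
  have [->|bn0] := eqVneq b 0; first by rewrite mulr0 subr0.
  have bgt0 : 0 < b by rewrite lt_def bn0.
  apply/ler_addgt0Pr => e' e'0.
  have /at_right0_ball[d d0 dP] : \forall h \near 0^'+, f (b - h) <= f b + e'.
    by apply: fl => //; rewrite bgt0.
  have [t Et bt] := sup_adherent d0 supE.
  have tb : t <= b by apply: ub_le_sup => //; case: supE.
  (* The left condition only concerns times strictly before [b], so the case where the approximating
     point is [b] itself is separate. *)
  have [tbE|tbN] := eqVneq t b.
    by case: Et => _; rewrite tbE => /le_trans; apply; rewrite lerDl ltW.
  have := dP (b - t); rewrite subr_gt0 lt_neqAle tbN tb/= subKr.
  have -> : b - t < d by rewrite ltrBlDr -ltrBlDl.
  move=> /(_ isT); apply: le_trans; case: Et => _; apply: le_trans.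
  by rewrite lerD2l lerN2 ler_pM2l.
have [bE|bN] := eqVneq b T; first by rewrite -bE; case: Eb.
have bltT : b < T by rewrite lt_neqAle bN.
have /at_right0_ball[d d0 dP] : \forall h \near 0^'+, f b + (0 - e) * h <= f (b + h).
  by apply: fr => //; rewrite b0.
pose h := Num.min (d / 2) (T - b).
have h0 : 0 < h by rewrite lt_min divr_gt0// subr_gt0.
have hd : h < d by rewrite gt_min ltr_pdivrMr// ltr_pMr// ltr1n.
have hT : h <= T - b by rewrite ge_min lexx orbT.
have : E (b + h).
  split; first by rewrite (addr_ge0 b0 (ltW h0)) -lerBrDl.
  apply: le_trans (dP h _); last by rewrite h0.
  rewrite sub0r mulNr mulrDr opprD addrA lerD2r; by case: Eb.
move=> /(ub_le_sup (proj2 supE)); rewrite -/b gerDl; by rewrite leNgt h0.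
Qed.

End right_derivatives.

(** * Supersolutions dominate smooth solutions of the backward equation *)

Section comparison.
Context {R : realType}.
Implicit Types (k i : int) (s t T K L : R).

(** The action of the matrix [m] on [w], restricted to nearest neighbours. It is exact for a
    nearest-neighbour generator; for transition probabilities and nonnegative [w] it is a lower
    bound of the full sum. *)
Definition nbr_sum (m : int -> int -> R) k (w : int -> R) : R :=
  m k (k - 1) * w (k - 1) + m k k * w k + m k (k + 1) * w (k + 1).

Lemma nbr_sum_le m k (v w : int -> R) : (forall i, 0 <= m k i) ->
  (forall i, v i <= w i) -> nbr_sum m k v <= nbr_sum m k w.
Proof. by move=> m0 vw; rewrite !lerD// ler_wpM2l. Qed.

Variables (p : R -> int -> int -> R) (q : int -> int -> R).
Variables (u : int -> R -> R).
Hypothesis p_ge0 : forall s k i, 0 <= s -> 0 <= p s k i.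
Hypothesis q_ge0 : forall k i, 0 <= q k i.
Hypothesis p_q : forall k i,
  (p s k i - (k == i)%:R) / s @[s --> 0^'+] --> q k i.
Hypothesis u_ge0 : forall k t, 0 <= t -> 0 <= u k t.
Hypothesis u_super : forall k s t, 0 <= s -> 0 <= t ->
  nbr_sum (p s) k (u^~ t) <= u k (s + t).

(** By [u_super], the three-term sum at time [s] is a minorant of [u k (s + t)], and its difference
    quotient tends to [nbr_sum q] entry by entry. *)
Lemma superharmonic_right_derivative k t : 0 <= t ->
  right_derivative_ge (u k) t (nbr_sum q k (u^~ t)).
Proof.
move=> t0; apply: (@right_derivative_ge_cvg _ _ (fun s => nbr_sum (p s) k (u^~ t))).
  have -> : (fun s => (nbr_sum (p s) k (u^~ t) - u k t) / s) =
     (fun s => nbr_sum (fun k i => (p s k i - (k == i)%:R) / s) k (u^~ t)).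
    apply/funext => s; rewrite /nbr_sum eqxx.
    have -> : (k == k - 1) = false by lia.
    have -> : (k == k + 1) = false by lia.
    by rewrite /= !subr0; ring.
  by apply: cvgD; [apply: cvgD|]; apply: cvgMl; exact: p_q.
near=> h; rewrite addrC; apply: u_super => //; exact: ltW.
Unshelve. all: by end_near. Qed.

Lemma p_diag_cvg k : p s k k @[s --> 0^'+] --> (1 : R).
Proof.
have -> : (1 : R) = q k k * 0 + 1 by rewrite mulr0 add0r.
have H : (p s k k - 1) / s * s + 1 @[s --> 0^'+] --> q k k * 0 + 1.
  apply: cvgD; last exact: cvg_cst.
  apply: cvgM; first by have := @p_q k k; rewrite eqxx.
  by apply: cvg_at_right_filter; exact: cvg_id.
apply: cvg_trans H; apply: near_eq_cvg; near=> s.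
have s0 : s != 0 by apply: lt0r_neq0; near: s; exact: nbhs_right_gt.
by rewrite divfK// subrK.
Unshelve. all: by end_near. Qed.

(** Keeping only the diagonal term of [u_super] gives [p h k k * u k (t - h) <= u k t], where
    [p h k k] tends to 1. *)
Lemma superharmonic_left k t e : 0 < t -> 0 < e ->
  \forall h \near 0^'+, u k (t - h) <= u k t + e.
Proof.
move=> t0 e0.
have ut0 : 0 <= u k t by apply: u_ge0; exact: ltW.
have H : (u k t + e) * p s k k @[s --> 0^'+] --> (u k t + e).
  rewrite -[X in _ --> X]mulr1; apply: cvgMr; exact: p_diag_cvg.
have /(cvgr_ge _ H) uH : u k t < u k t + e by rewrite ltrDl.
have /(cvgr_gt _ (p_diag_cvg k)) pH : 0 < (1 : R) by [].
near=> h.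
have h0 : 0 < h by near: h; exact: nbhs_right_gt.
have ht : h < t by near: h; exact: nbhs_right_lt.
have p0 : 0 < p h k k by near: h.
have th : 0 <= t - h by rewrite subr_ge0 ltW.
rewrite -(ler_pM2r p0).
have : u k t <= (u k t + e) * p h k k by near: h.
move=> /(le_trans _); apply; rewrite -[in leRHS](subrKC h t) mulrC.
apply: le_trans (u_super _ (ltW h0) th); rewrite /nbr_sum addrAC lerDr.
by rewrite addr_ge0// mulr_ge0 ?p_ge0 ?u_ge0// ltW.
Unshelve. all: by end_near. Qed.

Variables (H : int -> R -> R) (V : int -> R) (K L T : R).
Hypothesis H_solution : forall k t,
  is_derive t 1 (H k) (nbr_sum q k (H^~ t)).
Hypothesis H_init : forall k, H k 0 <= u k 0.
Hypothesis H_bound : forall k t, 0 <= t <= T -> H k t <= K * V k.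
Hypothesis K_ge0 : 0 <= K.
Hypothesis L_ge0 : 0 <= L.
Hypothesis V_super : forall k, nbr_sum q k V <= L * V k.

(* Integrating the bound for [n] gives the bound for [n.+1]: in [H - u] only the
   nonnegative matrix [q] acts, and it maps [V] below [L V]. *)
Lemma subsolution_le_iter n k t : 0 <= t <= T ->
  H k t - u k t <= K * exp_coeff (L * t) n * V k.
Proof.
elim: n k t => [|n IH] k t tT.
  rewrite /exp_coeff /= expr0 fact0 divr1 mulr1 lerBlDr.
  by apply: le_trans (H_bound _ tT) _; rewrite lerDl u_ge0//; case/andP: tT.
have /andP[t0 tT'] := tT.
pose c : R := K * V k * L ^+ n.+1 / (n.+1)`!%:R.
(* The constant [c] makes [c * t ^+ n.+1] the bound to be proved. The induction hypothesis gives [g]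
   a nonnegative lower right derivative, and [g 0] is nonnegative by [H_init]. *)
pose g := (fun s => u k s) \+ (fun s => c * s ^+ n.+1 - H k s).
have dg s : is_derive s 1 (fun s : R => c * s ^+ n.+1 - H k s)
    (c * (n.+1%:R * s ^+ n) - nbr_sum q k (H^~ s)).
  have d1 : is_derive s 1 (c *: (@id R ^+ n.+1)) (c * (n.+1%:R * s ^+ n)).
    by apply: is_derive_eq; rewrite /GRing.scale /= mulr1.
  have := is_deriveB d1 (H_solution k s).
  by congr (is_derive _ _ _ _); apply/funext => x; rewrite fctE /= exprfctE.
have : g 0 <= g t.
  apply: right_derivative_ge0_homo => // s /andP[s0 sT].
    apply: (@right_derivative_ge_le _ _ _ (nbr_sum q k (u^~ s) +
      (c * (n.+1%:R * s ^+ n) - nbr_sum q k (H^~ s)))).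
      have sT' : 0 <= s <= T by rewrite s0 (le_trans (ltW sT)).
      have := nbr_sum_le (q_ge0 k) (fun i => IH i s sT').
      have -> : nbr_sum q k (fun i => H i s - u i s) =
          nbr_sum q k (H^~ s) - nbr_sum q k (u^~ s).
        by rewrite /nbr_sum; ring.
      have -> : nbr_sum q k (fun i => K * exp_coeff (L * s) n * V i) =
          K * exp_coeff (L * s) n * nbr_sum q k V.
        by rewrite /nbr_sum; ring.
      have := ler_wpM2l (mulr_ge0 K_ge0 (exp_coeff_ge0 n (mulr_ge0 L_ge0 s0)))
        (V_super k).
      have -> : K * exp_coeff (L * s) n * (L * V k) = c * (n.+1%:R * s ^+ n).
        rewrite /exp_coeff /= /c exprMn factS natrM exprS.
        have f0 : n`!%:R != 0 :> R by rewrite pnatr_eq0 -lt0n fact_gt0.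
        have n0 : n.+1%:R != 0 :> R by rewrite pnatr_eq0.
        by field; rewrite f0 addrC natr1 n0.
      lra.
    apply: right_derivative_geD; first exact: superharmonic_right_derivative.
    exact: is_derive_right_derivative_ge.
  move=> e e0; have e20 : 0 < e / 2 by rewrite divr_gt0.
  have ds : {for s, continuous (fun s : R => c * s ^+ n.+1 - H k s)}.
    by apply: differentiable_continuous; apply/derivable1_diffP; case: (dg s).
  have cs : c * (s - h) ^+ n.+1 - H k (s - h) @[h --> 0^'+]
      --> c * s ^+ n.+1 - H k s.
    apply: cvg_at_right_filter.
    have sh : s - h @[h --> (0 : R)] --> s.
      by rewrite -{2}(subr0 s); apply: cvgB; [exact: cvg_cst|exact: cvg_id].
    exact: (continuous_cvg _ ds sh).
  have /(cvgr_le _ cs) cs' : c * s ^+ n.+1 - H k s <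
     c * s ^+ n.+1 - H k s + e / 2 by rewrite ltrDl.
  near=> h.
  have H1 : u k (s - h) <= u k s + e / 2 by near: h; exact: superharmonic_left.
  have H2 : c * (s - h) ^+ n.+1 - H k (s - h) <=
    c * s ^+ n.+1 - H k s + e / 2 by near: h.
  rewrite /g /=; lra.
rewrite /g /= expr0n/= mulr0 sub0r => ut.
have : 0 <= u k 0 - H k 0 by rewrite subr_ge0.
have -> : K * exp_coeff (L * t) n.+1 * V k = c * t ^+ n.+1.
  by rewrite /exp_coeff /= /c exprMn; ring.
lra.
Unshelve. all: by end_near. Qed.

(** The iterated bounds are multiples of the terms of the exponential series of [L * t], so they
    tend to 0. *)
Lemma subsolution_le k t : 0 <= t <= T -> H k t <= u k t.
Proof.
move=> tT; rewrite -subr_le0.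
have e0 : K * exp_coeff (L * t) n * V k @[n --> \oo] --> (0 : R).
  rewrite -(mul0r (V k)) -(mulr0 K); apply: cvgMl; apply: cvgMr.
  by apply: cvg_series_cvg_0; exact: is_cvg_series_exp_coeff.
rewrite -(cvg_lim _ e0)//; apply: limr_ge; first by apply/cvg_ex; exists 0.
by apply: nearW => n; exact: subsolution_le_iter.
Qed.

End comparison.

(** * The Gartner-Ellis theorem with a quadratic limit *)

Section limf.
Context {R : realType}.
Local Open Scope ereal_scope.

Lemma lt_ereal_dense (x y : \bar R) : x < y -> exists r : R, x < r%:E < y.
Proof.
case: x y => [x| |] [y| |]//=.
- rewrite lte_fin => xy; exists ((x + y) / 2)%R; rewrite !lte_fin; lra.
- by move=> _; exists (x + 1)%R; rewrite ltry lte_fin ltrDl ltr01.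
- by move=> _; exists (y - 1)%R; rewrite ltNyr lte_fin gtrDl ltrN10.
- by move=> _; exists 0%R; rewrite ltNyr ltry.
Qed.

Context {T : choiceType} {X : filteredType T}.
Implicit Types (f : X -> \bar R) (F : set_system X).

Lemma le_limf_einf f F (M : \bar R) :
  (forall r : R, r%:E < M -> \forall x \near F, r%:E <= f x) ->
  M <= limf_einf f F.
Proof.
move=> H; rewrite limf_einfE leNgt; apply/negP => /lt_ereal_dense[r /andP[rs rM]].
move: rs; rewrite ltNge => /negP; apply.
apply: le_ereal_sup_tmp; exists (ereal_inf (f @` [set x | r%:E <= f x])).
  by exists [set x | r%:E <= f x] => //; exact: H.
by apply: le_ereal_inf_tmp => _ [x /= rx <-].
Qed.

Lemma limf_esup_le f F (M : \bar R) :
  (forall r : R, M < r%:E -> \forall x \near F, f x <= r%:E) ->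
  limf_esup f F <= M.
Proof.
move=> H; rewrite limf_esupE leNgt; apply/negP => /lt_ereal_dense[r /andP[Mr rs]].
move: rs; rewrite ltNge => /negP; apply.
apply: ereal_inf_le; exists (ereal_sup (f @` [set x | f x <= r%:E])).
  by exists [set x | f x <= r%:E] => //; exact: H.
by apply: ge_ereal_sup => _ [x /= rx <-].
Qed.

End limf.

(** * Exponential bounds for a single random variable *)

Section chernoff.
Context {d} {T : measurableType d} {R : realType}.
Variables (P : probability T R) (Y : T -> R).
Hypothesis mY : measurable_fun setT Y.

Definition laplace (l : R) : \bar R := (\int[P]_w (expR (l * Y w))%:E)%E.

Lemma laplace_ge0 l : (0 <= laplace l)%E.
Proof. by apply: integral_ge0 => w _; rewrite lee_fin expR_ge0. Qed.

Let m_exp (l b : R) : measurable_fun setT (EFin \o (fun w => expR (l * Y w + b))).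
Proof.
apply/measurable_EFinP; apply: measurableT_comp => //.
by apply: measurable_funD => //; exact: measurable_funM.
Qed.

Let m_exp0 (l : R) : measurable_fun setT (EFin \o (fun w => expR (l * Y w))).
Proof.
by apply/measurable_EFinP; apply: measurableT_comp => //; exact: measurable_funM.
Qed.

Let m_indic (A : set T) : measurable A ->
  measurable_fun setT (EFin \o (\1_A : T -> R)).
Proof. by move=> mA; apply/measurable_EFinP; exact: measurable_indic. Qed.

Let exp_ge0 (x : R) : (0 <= (expR x)%:E)%E.
Proof. by rewrite lee_fin expR_ge0. Qed.

#[local] Hint Extern 0 (is_true (0 <= _)%E) => solve [exact: exp_ge0] : core.

Lemma integral_exp_affine l b :
  (\int[P]_w (expR (l * Y w + b))%:E = (expR b)%:E * laplace l)%E.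
Proof.
rewrite /laplace -ge0_integralZl_EFin ?expR_ge0//; last exact: m_exp0.
by apply: eq_integral => w _; rewrite -EFinM expRD mulrC.
Qed.

(** Two-sided Chernoff bound: on [A], one of the exponentials of [l * Y - l * m] and
    [- l * Y - l * m] is at least 1. *)
Lemma probability_le_laplace (A : set T) (m l : R) : measurable A -> 0 <= l ->
  (forall w, A w -> m <= `|Y w|) ->
  (P A <= (expR (- (l * m)))%:E * (laplace l + laplace (- l)))%E.
Proof.
move=> mA l0 Am.
rewrite ge0_muleDr ?laplace_ge0// -2!integral_exp_affine.
rewrite -ge0_integralD//; [|exact: m_exp|exact: m_exp].
rewrite -[A in P A]setIT -integral_indic//; apply: ge0_le_integral => //.
- exact: m_indic.
- by apply: emeasurable_funD; exact: m_exp.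
- move=> w _; rewrite -EFinD lee_fin indicE.
  have [|_] := boolP (w \in A); last by rewrite addr_ge0 ?expR_ge0.
  rewrite inE => /Am mw.
  have : 1 <= expR (`|l * Y w| - l * m).
    by rewrite -expR0 ler_expR normrM ger0_norm// -mulrBr mulr_ge0// subr_ge0.
  move=> /le_trans; apply.
  have [lY|lY] := leP 0 (l * Y w).
    by rewrite ger0_norm// lerDl expR_ge0.
  by rewrite ltr0_norm// mulNr lerDr expR_ge0.
Qed.

(* On the complement of the ball, the tilted mass is bounded by shifting the
   tilt [l] by [e] in both directions. *)
Lemma laplace_le_ball (A : set T) (y r l e : R) : measurable A -> 0 <= e ->
  (forall w, `|Y w - y| < r -> A w) ->
  (laplace l <= (expR (l * y + `|l| * r))%:E * P A +
    (expR (- (e * (y + r))))%:E * laplace (l + e) +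
    (expR (e * (y - r)))%:E * laplace (l - e))%E.
Proof.
move=> mA e0 yA.
rewrite -2!integral_exp_affine -[A in P A]setIT -integral_indic//.
rewrite -ge0_integralZl_EFin ?expR_ge0//; last exact: m_indic.
have m1 : measurable_fun setT (fun w => (expR (l * y + `|l| * r))%:E * (\1_A w)%:E)%E.
  by apply: measurable_funeM; exact: m_indic.
have p1 w : (0 <= (expR (l * y + `|l| * r))%:E * (\1_A w)%:E)%E.
  by rewrite mule_ge0// lee_fin.
have m2 : measurable_fun setT (fun w => (expR (l * y + `|l| * r))%:E * (\1_A w)%:E +
    (expR ((l + e) * Y w - e * (y + r)))%:E)%E.
  by apply: emeasurable_funD => //; exact: m_exp.
rewrite -ge0_integralD//; last exact: m_exp.
rewrite -ge0_integralD//; last exact: m_exp; last by move=> w _; exact: adde_ge0.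
apply: ge0_le_integral => //.
- exact: m_exp0.
- by apply: emeasurable_funD => //; exact: m_exp.
- move=> w _; rewrite -EFinM -!EFinD lee_fin indicE.
  have [wr|wr] := ltP `|Y w - y| r.
    have /yA Aw := wr; rewrite mem_set// mulr1 -addrA.
    apply: (@le_trans _ _ (expR (l * y + `|l| * r))); last by rewrite lerDl addr_ge0// expR_ge0.
    rewrite ler_expR -lerBlDl -mulrBr (le_trans (ler_norm _))// normrM.
    by rewrite ler_wpM2l// ltW.
  apply: (@le_trans _ _ (expR ((l + e) * Y w - e * (y + r)) +
     expR ((l - e) * Y w + e * (y - r)))); last first.
    by rewrite -addrA lerDr mulr_ge0// expR_ge0.
  (* Outside the ball, the sign of [Y w - y] decides which of the two shifted tilts dominates. *)
  have [Yy|Yy] := leP 0 (Y w - y).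
    rewrite ger0_norm// in wr; apply: (@le_trans _ _ (expR ((l + e) * Y w - e * (y + r)))).
      rewrite ler_expR; nra.
    by rewrite lerDl expR_ge0.
  rewrite ltr0_norm// in wr; apply: (@le_trans _ _ (expR ((l - e) * Y w + e * (y - r)))).
    rewrite ler_expR; nra.
  by rewrite lerDr expR_ge0.
Qed.

End chernoff.

Section gartner_ellis_quadratic.
Context {d} {T : measurableType d} {R : realType}.
Variables (P : probability T R) (Y : R -> T -> R) (v : R -> R) (s2 : R).
Hypothesis mY : forall t, measurable_fun setT (Y t).
Hypothesis s2_gt0 : 0 < s2.
Hypothesis v_cvgy : v t @[t --> +oo] --> +oo.
(** Convergence of the scaled log-Laplace transforms to [s2 * l ^+ 2 / 2], written without
    logarithms; the upper bound includes finiteness. *)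
Hypothesis laplace_asymp : forall l e, 0 < e -> \forall t \near +oo,
  ((expR (v t * (s2 * l ^+ 2 / 2 - e)))%:E <= laplace P (Y t) (v t * l)
     <= (expR (v t * (s2 * l ^+ 2 / 2 + e)))%:E)%E.

(** Lets constant factors be absorbed into an arbitrarily small part of the exponent. *)
Lemma near_expR_speed_ge (D M : R) : 0 < D ->
  \forall t \near +oo, M <= expR (v t * D).
Proof.
move=> D0; have /cvgryPge/(_ (M / D)) := v_cvgy.
apply: filterS => t; rewrite ler_pdivrMr// => Mv.
by apply: (le_trans Mv); apply: le_trans (expR_ge1Dx _); rewrite lerDr.
Qed.

Lemma near_speed_gt0 : \forall t \near +oo, 0 < v t.
Proof. by have /cvgryPgt/(_ 0) := v_cvgy. Qed.

(** The rate is even and grows with the distance to 0, so a set enters only through a lower bound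
    [m] for that distance. The tilt [m / s2] maximises [l * m - s2 * l ^+ 2 / 2]. *)
Lemma gartner_ellis_upper (A : R -> set T) (m e : R) : 0 <= m -> 0 < e ->
  (forall t, measurable (A t)) -> (forall t w, A t w -> m <= `|Y t w|) ->
  \forall t \near +oo,
    (P (A t) <= (expR (v t * (- (m ^+ 2 / (2 * s2)) + e)))%:E)%E.
Proof.
move=> m0 e0 mA Am; pose l := m / s2.
have l0 : 0 <= l by rewrite divr_ge0// ltW.
have e20 : 0 < e / 2 by rewrite divr_gt0.
near=> t.
have v0 : 0 < v t by near: t; exact: near_speed_gt0.
have /andP[_ H1] : ((expR (v t * (s2 * l ^+ 2 / 2 - e / 2)))%:E <=
    laplace P (Y t) (v t * l) <=
    (expR (v t * (s2 * l ^+ 2 / 2 + e / 2)))%:E)%E.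
  by near: t; exact: laplace_asymp.
have /andP[_ H2] : ((expR (v t * (s2 * (- l) ^+ 2 / 2 - e / 2)))%:E <=
    laplace P (Y t) (v t * - l) <=
    (expR (v t * (s2 * (- l) ^+ 2 / 2 + e / 2)))%:E)%E.
  by near: t; exact: laplace_asymp.
rewrite sqrrN mulrN in H2.
(* Half of [e] pays for the Laplace asymptotics, the other half for the factor 2 from adding the two
   tails. *)
have H3 : 2 <= expR (v t * (e / 2)) by near: t; exact: near_expR_speed_ge.
have vl0 : 0 <= v t * l by rewrite mulr_ge0// ltW.
apply: le_trans (probability_le_laplace P (mY t) (mA t) vl0 (Am t)) _.
apply: le_trans (lee_wpmul2l _ (leeD H1 H2)) _; first by rewrite lee_fin expR_ge0.
rewrite -EFinD -EFinM lee_fin mulrDr -expRD -mulr2n -[leLHS]mulr_natr.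
apply: (@le_trans _ _ (expR (- (v t * l * m) + v t * (s2 * l ^+ 2 / 2 + e / 2)) *
   expR (v t * (e / 2)))); first by rewrite ler_wpM2l ?expR_ge0.
rewrite -expRD ler_expR le_eqVlt; apply/orP; left; apply/eqP.
by rewrite /l; field; rewrite gt_eqF.
Unshelve. all: by end_near. Qed.

(** Under the tilt [l = y / s2] the mass concentrates near [y]: the part outside a small ball is
    exponentially smaller than the whole transform, so the ball carries at least half of it. Undoing
    the tilt costs [l * y - s2 * l ^+ 2 / 2], which is the rate at [y]. *)
Lemma gartner_ellis_lower (A : R -> set T) (y r e : R) : 0 < r -> 0 < e ->
  (forall t, measurable (A t)) -> (forall t w, `|Y t w - y| < r -> A t w) ->
  \forall t \near +oo,
    ((expR (v t * (- (y ^+ 2 / (2 * s2)) - e)))%:E <= P (A t))%E.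
Proof.
move=> r0 e0 mA yA; pose l := y / s2.
have l1 : 0 < `|l| + 1 by rewrite ltr_wpDl.
(* The radius bounds the variation of the tilt over the ball by [e / 4]; the added 1 covers
   [l = 0]. *)
pose D := Num.min r (e / (4 * (`|l| + 1))).
have D0 : 0 < D by rewrite lt_min r0 divr_gt0// mulr_gt0.
have Dr : D <= r by rewrite ge_min lexx.
have De : `|l| * D <= e / 4.
  have : D * (4 * (`|l| + 1)) <= e.
    by rewrite -ler_pdivlMr ?mulr_gt0// ge_min lexx orbT.
  by have := normr_ge0 l; lra.
(* This shift minimises [s2 * b ^+ 2 / 2 - b * D]; the minimum [- D * b / 2] is the gain outside the
   ball. *)
pose b := D / s2; have b0 : 0 <= b by rewrite divr_ge0// ltW.
have Db0 : 0 < D * b / 8 by rewrite !mulr_gt0 ?invr_gt0.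
(* The error in the Laplace asymptotics must not consume the gain [D * b / 2], and must fit the
   final budget of [e]. *)
pose k := Num.min (D * b / 8) (e / 4).
have k0 : 0 < k by rewrite lt_min Db0 divr_gt0.
have kD : k <= D * b / 8 by rewrite ge_min lexx.
have ke : k <= e / 4 by rewrite ge_min lexx orbT.
near=> t.
have v0 : 0 < v t by near: t; exact: near_speed_gt0.
have /andP[H1 _] : ((expR (v t * (s2 * l ^+ 2 / 2 - k)))%:E <=
    laplace P (Y t) (v t * l) <=
    (expR (v t * (s2 * l ^+ 2 / 2 + k)))%:E)%E.
  by near: t; exact: laplace_asymp.
have /andP[_ H2] : ((expR (v t * (s2 * (l + b) ^+ 2 / 2 - k)))%:E <=
    laplace P (Y t) (v t * (l + b)) <=
    (expR (v t * (s2 * (l + b) ^+ 2 / 2 + k)))%:E)%E.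
  by near: t; exact: laplace_asymp.
have /andP[_ H3] : ((expR (v t * (s2 * (l - b) ^+ 2 / 2 - k)))%:E <=
    laplace P (Y t) (v t * (l - b)) <=
    (expR (v t * (s2 * (l - b) ^+ 2 / 2 + k)))%:E)%E.
  by near: t; exact: laplace_asymp.
have H4 : 4 <= expR (v t * (D * b / 8)) by near: t; exact: near_expR_speed_ge.
have H5 : 2 <= expR (v t * (e / 4)).
  by near: t; apply: near_expR_speed_ge; rewrite divr_gt0.
have vb0 : 0 <= v t * b by rewrite mulr_ge0// ltW.
have yA' w : `|Y t w - y| < D -> A t w by move=> /lt_le_trans /(_ Dr); exact: yA.
have := laplace_le_ball P (mY t) (v t * l) (mA t) vb0 yA'.
rewrite -mulrDr -mulrBr => H6.
have {}H6 := le_trans H1 (le_trans H6 (leeD (leeD2l _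
  (lee_wpmul2l _ H2)) (lee_wpmul2l _ H3))).
have {H6} : ((expR (v t * (s2 * l ^+ 2 / 2 - k)))%:E <=
  (expR (v t * l * y + `|v t * l| * D))%:E * P (A t) +
  (expR (- (v t * b * (y + D))))%:E * (expR (v t * (s2 * (l + b) ^+ 2 / 2 + k)))%:E +
  (expR (v t * b * (y - D)))%:E * (expR (v t * (s2 * (l - b) ^+ 2 / 2 + k)))%:E)%E.
  by apply: H6; rewrite lee_fin expR_ge0.
have /fineK <- : P (A t) \is a fin_num by exact: fin_num_measure.
set p := fine _.
rewrite -!EFinM -!EFinD !lee_fin -!expRD.
have -> : - (v t * b * (y + D)) + v t * (s2 * (l + b) ^+ 2 / 2 + k) =
    v t * (s2 * l ^+ 2 / 2 - D * b / 2 + k).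
  by rewrite /l /b; field; rewrite gt_eqF.
have -> : v t * b * (y - D) + v t * (s2 * (l - b) ^+ 2 / 2 + k) =
    v t * (s2 * l ^+ 2 / 2 - D * b / 2 + k).
  by rewrite /l /b; field; rewrite gt_eqF.
rewrite normrM (gtr0_norm v0).
set c := s2 * l ^+ 2 / 2.
(* Each of the two terms from outside the ball is at most a quarter of the left side, so the ball
   term keeps half of it. *)
have H7 : 4 * expR (v t * (c - D * b / 2 + k)) <= expR (v t * (c - k)).
  apply: (@le_trans _ _ (expR (v t * (D * b / 8)) * expR (v t * (c - D * b / 2 + k)))).
    by rewrite ler_wpM2r ?expR_ge0.
  rewrite -expRD -mulrDr ler_expR ler_pM2l//; lra.
move=> H8.
have {H7 H8} : expR (v t * (c - k)) <= 2 * (expR (v t * l * y + v t * `|l| * D) * p).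
  lra.
have -> : v t * l * y + v t * `|l| * D = v t * (l * y + `|l| * D) by ring.
have p0 : 0 <= p by rewrite fine_ge0.
move=> H9.
rewrite -(ler_pM2l (expR_gt0 (v t * (l * y + `|l| * D)))) -(@ler_pM2l _ 2)//.
apply: le_trans H9; rewrite -expRD.
apply: (@le_trans _ _ (expR (v t * (e / 4)) * expR (v t * (l * y + `|l| * D) +
   v t * (- (y ^+ 2 / (2 * s2)) - e)))).
  by rewrite ler_wpM2r ?expR_ge0.
rewrite -expRD -!mulrDr ler_expR ler_pM2l//.
have -> : y ^+ 2 / (2 * s2) = c by rewrite /c /l; field; rewrite gt_eqF.
have -> : l * y = 2 * c by rewrite /c /l; field; rewrite gt_eqF.
lra.
Unshelve. all: by end_near. Qed.

Let I (y : R) : \bar R := (y ^+ 2 / (2 * s2))%:E.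

Lemma scaled_lne_le (x r : R) (p : \bar R) : 0 < x -> (0 <= p)%E ->
  (p <= (expR (x * r))%:E -> x^-1%:E * lne p <= r%:E)%E.
Proof.
move=> x0; case: p => [p| |//]; rewrite ?leye_eq// lee_fin => p0.
have [->|pn0] := eqVneq p 0.
  by move=> _; rewrite /= lexx gt0_muleNy ?leNye// lte_fin invr_gt0.
have {pn0}p0 : 0 < p by rewrite lt_def pn0.
rewrite lee_fin lne_EFin// -EFinM lee_fin ler_pdivrMl// => pr.
by rewrite -ler_expR lnK.
Qed.

Lemma scaled_lne_ge (x r : R) (p : \bar R) : 0 < x ->
  ((expR (x * r))%:E <= p -> r%:E <= x^-1%:E * lne p)%E.
Proof.
move=> x0; case: p => [p| |]; last by rewrite leeNy_eq.
  rewrite lee_fin => xp; have p0 : 0 < p by exact: lt_le_trans (expR_gt0 _) xp.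
  by rewrite lne_EFin// -EFinM lee_fin ler_pdivlMl// -ler_expR lnK.
by move=> _; rewrite /= gt0_muley ?leey// lte_fin invr_gt0.
Qed.

(** If [i] is the infimum of the rate over [C], every point of [C] has absolute value at least [m],
    where [m ^+ 2 / (2 * s2) = i]; the upper estimate then applies. *)
Lemma gartner_ellis_limsup (C : set R) :
  (forall t, measurable (Y t @^-1` C)) ->
  (limf_esup (fun t => (v t)^-1%:E * lne (P (Y t @^-1` C))) (pinfty_nbhs R)
    <= - ereal_inf (I @` C))%E.
Proof.
move=> mC; apply: limf_esup_le => r.
(* For the empty set the probability is 0 and its logarithm is [-oo]. Otherwise the infimum is a
   real number. *)
have [->|/set0P[y0 Cy0]] := eqVneq C set0.
  move=> _; near=> t.
  have v0 : 0 < v t by near: t; exact: near_speed_gt0.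
  rewrite preimage_set0 measure0 /= lexx gt0_muleNy ?leNye//.
  by rewrite lte_fin invr_gt0.
have I0 : (0 <= ereal_inf (I @` C))%E.
  apply: le_ereal_inf_tmp => _ [y _ <-].
  by rewrite lee_fin divr_ge0 ?sqr_ge0// mulr_ge0// ltW.
have Ile y : C y -> (ereal_inf (I @` C) <= I y)%E.
  by move=> Cy; apply: ereal_inf_lbound; exists y.
have : ereal_inf (I @` C) \is a fin_num.
  by rewrite ge0_fin_numE// (le_lt_trans (Ile _ Cy0))// ltry.
move: I0 Ile; case: (ereal_inf _) => [i| |]//; rewrite lee_fin => i0 Ile _.
rewrite -EFinN lte_fin => ir.
pose m := Num.sqrt (2 * s2 * i).
have s20 : 0 <= 2 * s2 * i by rewrite !mulr_ge0// ltW.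
have e0 : 0 < r + i by rewrite -ltrBlDr sub0r.
have Cm t w : (Y t @^-1` C) w -> m <= `|Y t w|.
  move=> /Ile; rewrite lee_fin ler_pdivlMr ?mulr_gt0// mulrC => Yi.
  by rewrite -sqrtr_sqr ler_wsqrtr.
near=> t.
have v0 : 0 < v t by near: t; exact: near_speed_gt0.
apply: scaled_lne_le => //.
have -> : r = - (m ^+ 2 / (2 * s2)) + (r + i).
  by rewrite sqr_sqrtr//; field; rewrite gt_eqF.
by near: t; apply: gartner_ellis_upper => //; exact: sqrtr_ge0.
Unshelve. all: by end_near. Qed.

(** Choose a point [y] of [O] with rate below [- r] and a ball around it inside [O]; the gap between
    the two is the error allowed to the lower estimate. *)
Lemma gartner_ellis_liminf (O : set R) : open O ->
  (forall t, measurable (Y t @^-1` O)) ->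
  (limf_einf (fun t => (v t)^-1%:E * lne (P (Y t @^-1` O))) (pinfty_nbhs R)
    >= - ereal_inf (I @` O))%E.
Proof.
move=> oO mO; apply: le_limf_einf => r; rewrite lteNr -EFinN.
move=> /ereal_inf_lt[_ [y Oy <-]]; rewrite lte_fin => yr.
have /nbhs_ballP[D /= D0 yD] : nbhs y O by exact: open_nbhs_nbhs.
have e0 : 0 < - r - y ^+ 2 / (2 * s2) by rewrite subr_gt0.
near=> t.
have v0 : 0 < v t by near: t; exact: near_speed_gt0.
apply: scaled_lne_ge => //.
have -> : r = - (y ^+ 2 / (2 * s2)) - (- r - y ^+ 2 / (2 * s2)) by ring.
near: t; apply: (gartner_ellis_lower D0) => // t w yw.
by apply: yD; rewrite /ball /= distrC.
Unshelve. all: by end_near. Qed.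

End gartner_ellis_quadratic.

(** * The function Lambda near the origin *)

Section taylor.
Context {R : realType}.

(** Peano form of the expansion, with a second derivative at 0 only: the remainder [p] has
    derivative of size at most [e * |x|] near 0, and the mean value theorem integrates this. *)
Lemma taylor2 (f f' : R -> R) (c : R) :
  (forall x : R, is_derive x 1 f (f' x)) -> is_derive (0 : R) 1 f' c ->
  forall e, 0 < e -> \forall x \near (0 : R),
    `|f x - f 0 - f' 0 * x - c / 2 * x ^+ 2| <= e * x ^+ 2.
Proof.
move=> df [df' f'c] e e0.
have H : \forall x \near (0 : R), `|f' x - f' 0 - c * x| <= e * `|x|.
  have : (f' h - f' 0) / h @[h --> 0^'] --> c.
    rewrite -f'c (_ : (fun h => _) = (fun h => h^-1 *: (f' (h *: 1 + 0) - f' 0))).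
      exact: df'.
    by apply/funext => h; rewrite /= [in RHS]/GRing.scale /= mulrC mulr1 addr0.
  move=> /cvgrPdist_le/(_ _ e0); rewrite near_withinE => H; near=> x.
  have [->|x0] := eqVneq x 0; first by rewrite subrr mulr0 subr0 normr0 mulr0.
  have Hx : `|c - (f' x - f' 0) / x| <= e by move: x0; near: x.
  have -> : f' x - f' 0 - c * x = - x * (c - (f' x - f' 0) / x).
    by field.
  by rewrite normrM normrN mulrC ler_wpM2r.
pose p x := f x - f' 0 * x - c / 2 * x ^+ 2.
have dp (x : R) : is_derive x 1 p (f' x - f' 0 - c * x).
  have d1 : is_derive x 1 ((f - f' 0 *: id) - (c / 2) *: (@id R ^+ 2)) (f' x - f' 0 - c * x).
    by apply: is_derive_eq; rewrite /GRing.scale /= expr1; field.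
  move: d1; congr (is_derive _ _ _ _); exact/funext.
have cp (x : R) : {for x, continuous p}.
  by apply: differentiable_continuous; apply/derivable1_diffP; case: (dp x).
have /nbhs_ballP[d /= d0 dH] := H; near=> x.
have xd : `|x| < d by near: x; apply: cvgr0_norm_lt => //; exact: cvg_id.
have -> : f x - f 0 - f' 0 * x - c / 2 * x ^+ 2 = p x - p 0.
  by rewrite /p; ring.
have pw u w : {within `[u, w], continuous p}.
  by apply: continuous_subspaceT => z; exact: cp.
have bnd z : `|z| <= `|x| -> `|f' z - f' 0 - c * z| <= e * `|x|.
  move=> zx; have /dH : ball (0 : R) d z.
    by rewrite /ball /= sub0r normrN (le_lt_trans zx).
  by move=> /le_trans; apply; rewrite ler_pM2l.
have [x0|x0] := leP 0 x.
  have [z] := MVT_segment x0 (fun z _ => dp z) (pw 0 x).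
  rewrite in_itv /= => /andP[z0 zx] ->; rewrite subr0 normrM expr2 mulrA.
  rewrite -(ger0_norm x0) normr_id ler_wpM2r//; last first.
  by apply: bnd; rewrite !ger0_norm.
have [z] := MVT_segment (ltW x0) (fun z _ => dp z) (pw x 0).
rewrite in_itv /= => /andP[z0 zx] E; rewrite distrC E sub0r normrM expr2 mulrA normrN.
have -> : e * x * x = e * `|x| * `|x| by rewrite ltr0_norm//; ring.
by rewrite ler_wpM2r//; apply: bnd; rewrite ler0_norm// ltr0_norm// lerN2.
Unshelve. all: by end_near. Qed.

End taylor.

(** * Lambda as a Perron eigenvalue, and its derivatives *)

Section Lambda_analysis.
Context {R : realType}.
Variables (alpha1 alpha2 beta1 beta2 : R).
Hypothesis alpha1_gt0 : 0 < alpha1.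
Hypothesis alpha2_gt0 : 0 < alpha2.
Hypothesis beta1_gt0 : 0 < beta1.
Hypothesis beta2_gt0 : 0 < beta2.
Local Notation L := (Lambda alpha1 alpha2 beta1 beta2).
Local Notation a := (alpha1 + alpha2).
Local Notation b := (beta1 + beta2).

(** On functions [k |-> e^(g k) r] with [r] depending on the parity of [k], the generator acts as
    the 2x2 matrix with rows [(- a, A g)] and [(B g, - b)]. *)
Definition tilted_even g : R := alpha1 * expR g + alpha2 * expR (- g).
Definition tilted_odd g : R := beta1 * expR g + beta2 * expR (- g).
Local Notation A := tilted_even.
Local Notation B := tilted_odd.

Lemma tilted_even_gt0 g : 0 < A g.
Proof. by rewrite addr_gt0// mulr_gt0// expR_gt0. Qed.

Lemma tilted_odd_gt0 g : 0 < B g.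
Proof. by rewrite addr_gt0// mulr_gt0// expR_gt0. Qed.

(** The discriminant of the characteristic polynomial of that matrix. *)
Let D g : R := (a - b) ^+ 2 + 4 * (A g * B g).

Let D_gt g : (a - b) ^+ 2 < D g.
Proof. by rewrite ltrDl !mulr_gt0// ?tilted_even_gt0 ?tilted_odd_gt0. Qed.

Let D_gt0 g : 0 < D g.
Proof. exact: le_lt_trans (sqr_ge0 _) (D_gt g). Qed.

Let LambdaE g : L g = 2^-1 * Num.sqrt (D g) - (a + b) / 2.
Proof.
rewrite /Lambda /h addrA.
have -> : (a - b) ^+ 2 * expR g ^+ 2 +
    4 * (beta1 * expR g ^+ 2 + beta2) * (alpha1 * expR g ^+ 2 + alpha2) =
    expR g ^+ 2 * D g.
  rewrite /D /tilted_even /tilted_odd expRN; field.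
  by rewrite gt_eqF// expR_gt0.
rewrite sqrtrM ?sqr_ge0// sqrtr_sqr ger0_norm ?expR_ge0//.
by congr (_ - _); field; rewrite gt_eqF// expR_gt0.
Qed.

(** This is the characteristic equation: [L g] is the larger eigenvalue of the matrix. *)
Lemma Lambda_eigen g : (L g + a) * (L g + b) = A g * B g.
Proof.
rewrite LambdaE.
have -> : (2^-1 * Num.sqrt (D g) - (a + b) / 2 + a) *
  (2^-1 * Num.sqrt (D g) - (a + b) / 2 + b) =
  (Num.sqrt (D g) ^+ 2 - (a - b) ^+ 2) / 4 by field.
by rewrite sqr_sqrtr ?(ltW (D_gt0 _))// /D; field.
Qed.

Let sqrtD_gt g : `|a - b| < Num.sqrt (D g).
Proof. by rewrite -sqrtr_sqr ltr_sqrt. Qed.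

Lemma Lambda_add_even_gt0 g : 0 < L g + a.
Proof. by have := sqrtD_gt g; have := ler_norm (b - a); rewrite LambdaE distrC; lra. Qed.

Let D0 : D 0 = (a + b) ^+ 2.
Proof. by rewrite /D /tilted_even /tilted_odd oppr0 expR0; ring. Qed.

Lemma Lambda0 : L 0 = 0.
Proof.
rewrite LambdaE D0 sqrtr_sqr ger0_norm ?addr_ge0 ?ltW//; first by field.
all: by rewrite addr_gt0.
Qed.

Let D' g : R := 4 * ((alpha1 * expR g - alpha2 * expR (- g)) * B g +
   A g * (beta1 * expR g - beta2 * expR (- g))).

Let dexp (p q x : R) : is_derive x 1 (fun g : R => p * expR g + q * expR (- g))
  (p * expR x - q * expR (- x)).
Proof.
by apply: is_derive_eq; rewrite /GRing.scale /= ?mulrN1 ?mulr1; ring.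
Qed.

Let dD (x : R) : is_derive x 1 D (D' x).
Proof.
have dA : is_derive x 1 A (alpha1 * expR x - alpha2 * expR (- x)) by exact: dexp.
have dB : is_derive x 1 B (beta1 * expR x - beta2 * expR (- x)) by exact: dexp.
rewrite /D; apply: is_derive_eq; rewrite /GRing.scale /= /D' add0r; ring.
Qed.

Let dD' (x : R) : is_derive x 1 D' (8 * (A x * B x +
  (alpha1 * expR x - alpha2 * expR (- x)) * (beta1 * expR x - beta2 * expR (- x)))).
Proof.
have dA : is_derive x 1 A (alpha1 * expR x - alpha2 * expR (- x)) by exact: dexp.
have dB : is_derive x 1 B (beta1 * expR x - beta2 * expR (- x)) by exact: dexp.
have dA' : is_derive x 1 (fun g => alpha1 * expR g - alpha2 * expR (- g)) (A x).
  by have := dexp alpha1 (- alpha2) x; rewrite mulNr opprK; under eq_fun do rewrite mulNr.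
have dB' : is_derive x 1 (fun g => beta1 * expR g - beta2 * expR (- g)) (B x).
  by have := dexp beta1 (- beta2) x; rewrite mulNr opprK; under eq_fun do rewrite mulNr.
rewrite /D'; apply: is_derive_eq; rewrite /GRing.scale /=; ring.
Qed.

Let dsqrtD (x : R) : is_derive x 1 (fun g => Num.sqrt (D g)) (D' x / (2 * Num.sqrt (D x))).
Proof.
apply: is_derive_eq; first exact: (is_derive1_comp (is_derive1_sqrt (D_gt0 x)) (dD x)).
by rewrite mulrC.
Qed.

Let L' x : R := 2^-1 * (D' x / (2 * Num.sqrt (D x))).

Let is_derive_Lambda (x : R) : is_derive x 1 L (L' x).
Proof.
have -> : L = fun g => 2^-1 * Num.sqrt (D g) - (a + b) / 2.
  by apply/funext => g; exact: LambdaE.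
have dS := dsqrtD x; apply: is_derive_eq; by rewrite /GRing.scale /= ?subr0.
Qed.

Let derive1_Lambda : L^`()%classic = L'.
Proof.
by apply/funext => x; rewrite derive1E; exact: (@derive_val _ _ _ _ _ _ _ (is_derive_Lambda x)).
Qed.

Let S := a + b.
Let S_gt0 : 0 < S. Proof. by rewrite !addr_gt0. Qed.

Let sqrtD0 : Num.sqrt (D 0) = S.
Proof. by rewrite D0 sqrtr_sqr ger0_norm// ltW. Qed.

(** Closed form of the second derivative of Lambda at 0. *)
Let L2 : R := 4 * (alpha1 * beta1 + alpha2 * beta2) / S -
  8 * (alpha1 * beta1 - alpha2 * beta2) ^+ 2 / S ^+ 3.

Let is_derive_L' : is_derive (0 : R) 1 L' L2.
Proof.
have SN : Num.sqrt (D 0) != 0 by rewrite sqrtD0 gt_eqF.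
have dV : is_derive (0 : R) 1 (fun g => (Num.sqrt (D g))^-1)
    (- (Num.sqrt (D 0)) ^- 2 * (D' 0 / (2 * Num.sqrt (D 0)))).
  exact: is_deriveV.
have dDx := dD' 0; have -> : L' = fun g => 4^-1 * (D' g * (Num.sqrt (D g))^-1).
  by apply/funext => g; rewrite /L'; field; rewrite gt_eqF// sqrtr_gt0.
apply: is_derive_eq; rewrite /GRing.scale /= sqrtD0.
rewrite /D' /L2 /tilted_even /tilted_odd oppr0 expR0 /S.
by field; rewrite gt_eqF.
Qed.

Lemma derive2_Lambda0_gt0 : 0 < (L^`(2))%classic 0.
Proof.
have -> : (L^`(2))%classic 0 = L2.
  by rewrite /derive1n /= derive1_Lambda derive1E; exact: (@derive_val _ _ _ _ _ _ _ is_derive_L').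
rewrite /L2 subr_gt0 ltr_pdivrMr ?exprn_gt0//.
have -> : 4 * (alpha1 * beta1 + alpha2 * beta2) / S * S ^+ 3 =
   4 * (alpha1 * beta1 + alpha2 * beta2) * S ^+ 2 by field; rewrite gt_eqF.
have p0 : 0 < alpha1 * beta1 by rewrite mulr_gt0.
have q0 : 0 < alpha2 * beta2 by rewrite mulr_gt0.
have r0 : 0 < alpha1 * beta2 by rewrite mulr_gt0.
have t0 : 0 < alpha2 * beta1 by rewrite mulr_gt0.
(* With [p] and [q] the products [alpha1 * beta1] and [alpha2 * beta2], this yields [4 (p + q) S^2 >
   16 (p + q)^2 >= 8 (p - q)^2]. *)
have HS : 4 * (alpha1 * beta1 + alpha2 * beta2) < S ^+ 2.
  have : 4 * (alpha1 * beta1 + alpha2 * beta2) < 4 * (a * b) by lra.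
  move=> /lt_le_trans; apply; rewrite -subr_ge0.
  have -> : S ^+ 2 - 4 * (a * b) = (a - b) ^+ 2 by rewrite /S; ring.
  exact: sqr_ge0.
nra.
Qed.

Lemma Lambda_taylor e : 0 < e -> \forall g \near (0 : R),
  `|L g - (L^`() 0)%classic * g - (L^`(2))%classic 0 / 2 * g ^+ 2| <= e * g ^+ 2.
Proof.
move=> e0.
have -> : (L^`(2))%classic 0 = L2.
  by rewrite /derive1n /= derive1_Lambda derive1E; exact: (@derive_val _ _ _ _ _ _ _ is_derive_L').
rewrite derive1_Lambda.
have := taylor2 is_derive_Lambda is_derive_L' e0.
by apply: filterS => g; rewrite Lambda0 subr0.
Qed.

(** The ratio of the two eigenvector components equals 1 at [g = 0] and is continuous there. *)
Lemma perron_ratio_near : \forall g \near (0 : R), 2^-1 <= (L g + a) / A g <= 2.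
Proof.
have cL : {for 0, continuous L}.
  by apply: differentiable_continuous; apply/derivable1_diffP; case: (is_derive_Lambda 0).
have cA : {for 0, continuous A}.
  by apply: differentiable_continuous; apply/derivable1_diffP; case: (dexp alpha1 alpha2 0).
have A0 : A 0 = a by rewrite /tilted_even oppr0 expR0 !mulr1.
have aN : a != 0 by rewrite gt_eqF// addr_gt0.
have H : (L g + a) / A g @[g --> (0 : R)] --> (1 : R).
  rewrite (_ : 1 = (L 0 + a) / A 0); last by rewrite Lambda0 A0 add0r divff.
  by apply: cvgM; [apply: cvgD => //; exact: cvg_cst|apply: cvgV => //; rewrite A0].
near=> g; apply/andP; split; near: g.
- by apply: (cvgr_ge _ H); lra.
- by apply: (cvgr_le _ H); lra.
Unshelve. all: by end_near. Qed.

End Lambda_analysis.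

(** * Expectations along the chain *)

Section discrete_expectation.
Context {d} {T : measurableType d} {R : realType}.
Variable mu : {measure set T -> \bar R}.
Implicit Types (Z : {mfun T >-> int}) (f : int -> R) (D : set T).

Lemma measurable_preimage_int Z (B : set int) : measurable (Z @^-1` B).
Proof. by rewrite -[X in measurable X]setTI; exact: measurable_funPT. Qed.

Lemma measurable_int_comp Z f D : measurable_fun D (EFin \o (fun w => f (Z w))).
Proof.
apply: measurable_funTS => _ B _; rewrite setTI.
exact: (measurable_preimage_int Z (f @^-1` (EFin @^-1` B))).
Qed.

(* Unlike [unpickle], [pickle_inv] is injective where it is not [None], so that
   the events [pickle_inv n = Some (Z w)] are pairwise disjoint. *)
Lemma ge0_integral_int_series Z f D : measurable D -> (forall x, 0 <= f x) ->
  (\int[mu]_(w in D) (f (Z w))%:E =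
   \sum_(0 <= n <oo) (oapp f 0 (pickle_inv n))%:E *
     mu (D `&` [set w | pickle_inv n = Some (Z w)]))%E.
Proof.
move=> mD f0; pose F n := D `&` [set w | pickle_inv n = Some (Z w)].
have mF n : measurable (F n).
  apply: measurableI => //.
  exact: (measurable_preimage_int Z [set x | pickle_inv n = Some x]).
have DF : D = \bigcup_n F n.
  apply/seteqP; split=> [w Dw|w [n _ []//]].
  by exists (pickle (Z w)) => //; split => //=; rewrite pickleK_inv.
rewrite [in LHS]DF ge0_integral_bigcup//.
- apply: eq_eseriesr => n _.
  rewrite (eq_integral (cst (oapp f 0 (pickle_inv n))%:E)); last first.
    by move=> w; rewrite inE => -[_ /= ->].
  by rewrite integral_cst.
- exact: measurable_int_comp.
- by move=> w _; rewrite lee_fin.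
- apply/trivIsetP => m n _ _ mn; rewrite -subset0 => w [[_ /= mw] [_ /= nw]].
  move: mn; rewrite -(pickle_invK (T := int) m) -(pickle_invK (T := int) n).
  by rewrite /oapp mw nw eqxx.
Qed.

End discrete_expectation.

(** * Consequences of the Markov property for expectations *)

Section markov_property.
Context {R : realType} {d : measure_display} {Omega : measurableType d}.
Variables (P : int -> probability Omega R) (X : R -> {mfun Omega >-> int}).
Hypothesis hX : is_markov_chain P X.
Implicit Types (psi : int -> R) (k i : int) (s t : R).

Definition chain_mean psi k t : \bar R := (\int[P k]_w (psi (X t w))%:E)%E.

Lemma chain_mean_ge0 psi k t : (forall x, 0 <= psi x) ->
  (0 <= chain_mean psi k t)%E.
Proof. by move=> psi0; apply: integral_ge0 => w _; rewrite lee_fin. Qed.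

(** Both integrals are expanded over the values of the final state and compared term by term; only
    the present state is conditioned on, so the list [past] is empty. *)
Lemma markov_integral psi k i s t : (forall x, 0 <= psi x) -> 0 <= s -> 0 <= t ->
  (\int[P k]_(w in [set w | X s w = i]) (psi (X (s + t) w))%:E =
   P k [set w | X s w = i] * chain_mean psi i t)%E.
Proof.
move=> psi0 s0 t0; rewrite /chain_mean.
rewrite (ge0_integral_int_series (P k) (X (s + t)))//; last first.
  exact: (measurable_preimage_int (X s) [set i]).
rewrite (ge0_integral_int_series (P i) (X t))//.
have mXs : measurable [set w | X s w = i] := measurable_preimage_int (X s) [set i].
have /fineK <- : P k [set w | X s w = i] \is a fin_num by exact: fin_num_measure.
rewrite -nneseriesZl//; last first.
  move=> n _; rewrite mule_ge0// lee_fin; by case: (pickle_inv n) => /=.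
apply: eq_eseriesr => n _; rewrite muleCA setTI; congr (_ * _)%E.
rewrite fineK ?fin_num_measure//.
case: (pickle_inv n) => [j|]; last first.
  have E (Z : Omega -> int) : [set w | None = Some (Z w)] = set0 by apply/seteqP; split.
  by rewrite !E setI0 !measure0 mule0.
have [_ /(_ k i j s t [::] s0 t0)] := hX.
have E1 : [set w | X s w = i /\ forall u : R * int, u \in [::] -> X u.1 w = u.2] =
    [set w | X s w = i] by apply/seteqP; split=> w /= [].
have E2 (Z : Omega -> int) : [set w | Some j = Some (Z w)] = [set w | Z w = j].
  by apply/seteqP; split=> w /= => [[->]|->].
by rewrite /= E1 !E2; apply.
Qed.

(** Discarding all intermediate states but three keeps an inequality, and avoids interchanging a
    derivative with an infinite sum. *)
Lemma chain_mean_super psi k s t : (forall x, 0 <= psi x) -> 0 <= s -> 0 <= t ->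
  (P k [set w | X s w = (k - 1)%R] * chain_mean psi (k - 1) t +
   P k [set w | X s w = k] * chain_mean psi k t +
   P k [set w | X s w = (k + 1)%R] * chain_mean psi (k + 1) t <=
   chain_mean psi k (s + t))%E.
Proof.
move=> psi0 s0 t0; rewrite -!markov_integral//.
have mX (i : int) : measurable [set w | X s w = i].
  exact: (measurable_preimage_int (X s) [set i]).
have mf D := measurable_int_comp (X (s + t)) psi D.
have p0 w : (0 <= (psi (X (s + t) w))%:E)%E by rewrite lee_fin.
rewrite -ge0_integral_setU//; last 2 first.
  exact: mf.
  by apply/disj_set2P; rewrite -subset0 => w [/= ->]; lia.
rewrite -ge0_integral_setU//; last 3 first.
  by apply: measurableU.
  exact: mf.
  by apply/disj_set2P; rewrite -subset0 => w [[/= ->|/= ->]]; lia.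
apply: ge0_subset_integral => //; [by do 2? apply: measurableU|exact: mf].
Qed.

End markov_property.

Lemma nbr_sum_generator {R : realType} (alpha1 alpha2 beta1 beta2 : R) k
  (w : int -> R) : nbr_sum (alternating_generator alpha1 alpha2 beta1 beta2) k w =
  if (2 %| k)%Z
  then alpha2 * w (k - 1) - (alpha1 + alpha2) * w k + alpha1 * w (k + 1)
  else beta2 * w (k - 1) - (beta1 + beta2) * w k + beta1 * w (k + 1).
Proof.
rewrite /nbr_sum /alternating_generator.
have -> : (k - 1 == k + 1) = false by lia.
have -> : (k == k + 1) = false by lia.
have -> : (k == k - 1) = false by lia.
by rewrite !eqxx; case: ifP => _; rewrite mulNr.
Qed.

(** * The comparison principle for the alternating chain *)

Section alternating_chain.
Context {R : realType} {d : measure_display} {Omega : measurableType d}.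
Variables (alpha1 alpha2 beta1 beta2 : R).
Hypothesis alpha1_gt0 : 0 < alpha1.
Hypothesis alpha2_gt0 : 0 < alpha2.
Hypothesis beta1_gt0 : 0 < beta1.
Hypothesis beta2_gt0 : 0 < beta2.
Variables (P : int -> probability Omega R) (X : R -> {mfun Omega >-> int}).
Hypothesis hX : is_markov_chain P X.
Local Notation g := (alternating_generator alpha1 alpha2 beta1 beta2).
Hypothesis hgen : has_generator P X g.
Local Notation a := (alpha1 + alpha2).
Local Notation b := (beta1 + beta2).
Local Notation E := (chain_mean P X).

(** The shift [c] dominates both exit rates, so adding it on the diagonal makes every entry of [q]
    nonnegative. It corresponds to multiplying all functions of time by [expR (c * s)]. *)
Let c := a + b.
Let q k i : R := g k i + c * (k == i)%:R.

Let q_ge0 k i : 0 <= q k i.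
Proof.
rewrite /q /alternating_generator /c.
have [->|ki] := eqVneq k i.
  have -> : (i == i + 1) = false by lia.
  have -> : (i == i - 1) = false by lia.
  by case: ifP => _ /=; rewrite mulr1 addrC ?addrK 1?[a + _]addrC ?addrK addr_ge0// ltW.
by rewrite mulr0 addr0; do 3? [case: ifP => _ //=]; exact: ltW.
Qed.

Let nbr_sum_q k (w : int -> R) : nbr_sum q k w = nbr_sum g k w + c * w k.
Proof.
rewrite /nbr_sum /q eqxx.
have -> : (k == k - 1) = false by lia.
have -> : (k == k + 1) = false by lia.
by rewrite /=; ring.
Qed.

Let p (s : R) k i : R := expR (c * s) * state_probability P X k i s.

Let p_q k i : (p s k i - (k == i)%:R) / s @[s --> 0^'+] --> q k i.
Proof.
have de : is_derive (0 : R) 1 (fun s : R => expR (c * s)) c.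
  by apply: is_derive_eq; rewrite mulr0 expR0 mul1r [LHS]mulr1.
have ce : (expR (c * s) - 1) / s @[s --> 0^'+] --> c.
  apply: cvg_dnbhs_at_right; case: de => de1 de2; rewrite -[X in _ --> X]de2.
  rewrite (_ : (fun _ => _) = (fun h => h^-1 *: (expR (c * (h *: 1 + 0)) - expR (c * 0)))).
    exact: de1.
  apply/funext => s; have -> : s *: (1 : R) + 0 = s by rewrite addr0 [LHS]mulr1.
  by rewrite mulr0 expR0 [RHS]mulrC.
have ec : expR (c * s) @[s --> 0^'+] --> (1 : R).
  apply: cvg_at_right_filter.
  have : {for (0 : R), continuous (fun s : R => expR (c * s))}.
    by apply: differentiable_continuous; apply/derivable1_diffP; case: de.
  by rewrite /prop_for /continuous_at mulr0 expR0.
rewrite (_ : (fun s => _) = (fun s => expR (c * s) *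
   ((state_probability P X k i s - state_probability P X k i 0) / s) +
   (expR (c * s) - 1) / s * (k == i)%:R)).
  rewrite /q -[g k i]mul1r; apply: cvgD; first by apply: cvgM => //; exact: hgen.
  by apply: cvgMl.
by apply/funext => s; have [/(_ k i) -> _] := hX; rewrite /p; ring.
Qed.

(** The comparison principle applied to [H] and [E psi], both multiplied by [expR (c * s)]. The
    positive eigenfunction [V] only controls the growth of [H] in space. *)
Lemma chain_mean_subsolution (psi V : int -> R) (mu K T : R) (H : int -> R -> R) :
  (forall x, 0 <= psi x) ->
  (forall k t, 0 <= t -> (E psi k t < +oo)%E) ->
  (forall k, 0 < V k) -> (forall k, nbr_sum g k V = mu * V k) -> 0 <= K ->
  (forall k (t : R), is_derive t 1 (H k) (nbr_sum g k (H^~ t))) ->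
  (forall k, H k 0 <= psi k) ->
  (forall k t, 0 <= t <= T -> H k t <= K * V k) ->
  forall k t, 0 <= t <= T -> ((H k t)%:E <= E psi k t)%E.
Proof.
move=> psi0 fin V0 VE K0 dH H0 HK k t tT.
have /andP[t0 tT'] := tT.
have finE k' s : 0 <= s -> E psi k' s \is a fin_num.
  by move=> s0; rewrite ge0_fin_numE ?fin// chain_mean_ge0.
pose u k' s := expR (c * s) * fine (E psi k' s).
pose H' k' s := expR (c * s) * H k' s.
have c0 : 0 <= c by rewrite /c !addr_ge0 ?ltW.
have Pfin k' s i : P k' [set w | X s w = i] \is a fin_num.
  by apply: fin_num_measure; exact: (measurable_preimage_int (X s) [set i]).
(* The event that the chain sits at [k'] at time 0 has probability 1 under [P k']. *)
have psi_0 k' : psi k' <= fine (E psi k' 0).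
  have [X0 _] := hX; have := X0 k' k'; rewrite /state_probability eqxx => Xk.
  have m0 : measurable [set w | X 0 w = k'] := measurable_preimage_int (X 0) [set k'].
  rewrite -lee_fin fineK ?finE// -[(psi k')%:E]mule1.
  have -> : 1%E = P k' [set w | X 0 w = k'] by rewrite -[RHS]fineK// Xk.
  rewrite -integral_cst//.
  rewrite (eq_integral (fun w => (psi (X 0 w))%:E)).
    apply: ge0_subset_integral => //; first exact: measurable_int_comp.
    by move=> w _; rewrite lee_fin.
  by move=> w; rewrite inE => /= ->.
suff : H' k t <= u k t.
  by rewrite /H' /u ler_pM2l ?expR_gt0// -lee_fin fineK ?finE.
(* This is the eigenvalue of the entrywise nonnegative matrix [q] at the positive function [V]. *)
have mu0 : 0 <= mu + c.
  rewrite -(pmulr_lge0 _ (V0 k)) mulrDl -VE -nbr_sum_q /nbr_sum.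
  by rewrite !addr_ge0// mulr_ge0// ltW.
apply: (@subsolution_le _ p q u _ _ _ _ _ H' V (expR (c * T) * K) (mu + c) T) => //.
- by move=> s k' i s0; rewrite mulr_ge0 ?expR_ge0 ?fine_ge0.
- move=> k' s s0; rewrite mulr_ge0 ?expR_ge0// fine_ge0// chain_mean_ge0//.
- move=> k' s s' s0 s'0.
  have := chain_mean_super hX k' psi0 s0 s'0.
  rewrite -(fineK (finE k' (s + s') (addr_ge0 s0 s'0))).
  rewrite -[X in (X + _ + _ <= _)%E]fineK ?fin_numM ?finE//.
  rewrite -[X in (_ + X + _ <= _)%E]fineK ?fin_numM ?finE//.
  rewrite -[X in (_ + _ + X <= _)%E]fineK ?fin_numM ?finE//.
  rewrite -!EFinD lee_fin !fineM ?finE// => le_super.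
  rewrite /u /nbr_sum /p /state_probability mulrDr expRD.
  have := ler_wpM2l (expR_ge0 (c * s + c * s')) le_super.
  by rewrite expRD; congr (_ <= _); ring.
- move=> k' s; have dHk := dH k' s; rewrite /H'.
  apply: is_derive_eq; rewrite /GRing.scale /= nbr_sum_q /nbr_sum; ring.
- by move=> k'; rewrite /H' /u mulr0 expR0 !mul1r (le_trans (H0 _)).
- move=> k' s sT; rewrite /H' -mulrA; have /andP[s0 sT'] := sT.
  apply: (@le_trans _ _ (expR (c * s) * (K * V k'))).
    by rewrite ler_wpM2l ?expR_ge0// HK.
  apply: ler_wpM2r; first exact: mulr_ge0 K0 (ltW (V0 _)).
  by rewrite ler_expR; exact: (ler_wpM2l c0 sT').
- by rewrite mulr_ge0// expR_ge0.
- by move=> k'; rewrite nbr_sum_q VE [(mu + c) * _]mulrDl.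
Qed.

End alternating_chain.

(** * Expectation of a positive eigenfunction *)

Section perron_eigenfunction.
Context {R : realType} {d : measure_display} {Omega : measurableType d}.
Variables (alpha1 alpha2 beta1 beta2 : R).
Hypothesis alpha1_gt0 : 0 < alpha1.
Hypothesis alpha2_gt0 : 0 < alpha2.
Hypothesis beta1_gt0 : 0 < beta1.
Hypothesis beta2_gt0 : 0 < beta2.
Variables (P : int -> probability Omega R) (X : R -> {mfun Omega >-> int}).
Hypothesis hX : is_markov_chain P X.
Local Notation G := (alternating_generator alpha1 alpha2 beta1 beta2).
Hypothesis hgen : has_generator P X G.
Local Notation a := (alpha1 + alpha2).
Local Notation b := (beta1 + beta2).
Local Notation L := (Lambda alpha1 alpha2 beta1 beta2).
Local Notation E := (chain_mean P X).

Let subsolution := chain_mean_subsolution alpha1_gt0 alpha2_gt0 beta1_gt0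
  beta2_gt0 hX hgen.

Lemma chain_mean_le (f h : int -> R) k t : (forall x, 0 <= f x) ->
  (forall x, f x <= h x) -> (E f k t <= E h k t)%E.
Proof.
move=> f0 fh; apply: ge0_le_integral => //.
- by move=> w _; rewrite lee_fin.
- exact: measurable_int_comp.
- exact: measurable_int_comp.
- by move=> w _; rewrite lee_fin.
Qed.

Lemma chain_meanD (f h : int -> R) k t : (forall x, 0 <= f x) ->
  (forall x, 0 <= h x) -> (E (fun x => f x + h x)%R k t = E f k t + E h k t)%E.
Proof.
move=> f0 h0; rewrite -ge0_integralD//.
- by move=> w _; rewrite lee_fin.
- exact: measurable_int_comp.
- by move=> w _; rewrite lee_fin.
- exact: measurable_int_comp.
Qed.

Lemma chain_meanZ (f : int -> R) (r : R) k t : (forall x, 0 <= f x) -> 0 <= r ->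
  (E (fun x => r * f x)%R k t = r%:E * E f k t)%E.
Proof.
move=> f0 r0; rewrite -ge0_integralZl_EFin//.
- by move=> w _; rewrite lee_fin.
- exact: measurable_int_comp.
Qed.

Lemma chain_mean_cst (r : R) k t : E (fun=> r) k t = r%:E.
Proof. by rewrite /chain_mean integral_cst//= probability_setT mule1. Qed.

Variables (V : int -> R) (lam : R).
Hypothesis V_gt0 : forall k, 0 < V k.
Hypothesis V_eigen : forall k, nbr_sum G k V = lam * V k.

Let trunc (n : nat) x : R := Num.min (V x) n%:R.

Let trunc_ge0 n x : 0 <= trunc n x.
Proof. by rewrite le_min ler0n ltW. Qed.

(** Comparison gives only lower bounds, so it is applied to the bounded function [n - min(V, n)] and
    the solution [n - V e^(lam t)], the generator annihilating constants. *)
Lemma chain_mean_trunc_le n k t : 0 <= t ->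
  (E (trunc n) k t <= (V k * expR (lam * t))%:E)%E.
Proof.
move=> t0.
pose psi x : R := n%:R - trunc n x.
have psi0 x : 0 <= psi x by rewrite subr_ge0 ge_min lexx orbT.
have psin x : psi x <= n%:R by rewrite gerBl.
have finpsi k' s : (E psi k' s < +oo)%E.
  apply: le_lt_trans (chain_mean_le _ _ psi0 psin) _.
  by rewrite chain_mean_cst ltry.
have Esum : (E psi k t + E (trunc n) k t = n%:R%:E)%E.
  rewrite -chain_meanD// -(chain_mean_cst n%:R k t).
  by congr (E _ k t); apply/funext => x; rewrite subrK.
have finT : E (trunc n) k t \is a fin_num.
  rewrite ge0_fin_numE ?chain_mean_ge0//.
  have Tn x : trunc n x <= n%:R by rewrite ge_min lexx orbT.
  by apply: le_lt_trans (chain_mean_le _ _ (@trunc_ge0 n) Tn) _; rewrite chain_mean_cst ltry.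
have : ((n%:R - V k * expR (lam * t))%:E <= E psi k t)%E.
  have tt : 0 <= t <= t by rewrite t0 lexx.
  (* The solution is at most [n], so the constant 1, with eigenvalue 0, controls its growth. *)
  apply: (@subsolution psi (fun=> 1) 0 n%:R t
    (fun k t => n%:R - V k * expR (lam * t)) psi0 (fun k s _ => finpsi k s) _ _ _ _ _ _ k t tt) => //.
  - by move=> k'; rewrite nbr_sum_generator; case: (2 %| k')%Z => /=; ring.
  - move=> k' s; apply: is_derive_eq; rewrite /GRing.scale /=.
    transitivity (- expR (lam * s) * nbr_sum G k' V).
      by rewrite V_eigen; ring.
    by rewrite !nbr_sum_generator; case: (2 %| k')%Z => /=; ring.
  - by move=> k'; rewrite mulr0 expR0 mulr1 lerD2l lerN2 ge_min lexx.
  - by move=> k' s _; rewrite mulr1 gerBl mulr_ge0 ?expR_ge0// ltW.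
move: Esum finT; case: (E psi k t) (finpsi k t) => [x| |]//;
  case: (E (trunc n) k t) => [y| |]// _ [xy] _; rewrite !lee_fin; lra.
Qed.

(** The upper bound follows from the truncations by monotone convergence. It makes [E V] finite, as
    the comparison with [V] itself requires for the lower bound. *)
Lemma chain_mean_eigen k t : 0 <= t ->
  E V k t = (V k * expR (lam * t))%:E.
Proof.
move=> t0; have V0 x : 0 <= V x by exact: ltW.
have le_V k' s : 0 <= s -> (E V k' s <= (V k' * expR (lam * s))%:E)%E.
  move=> s0.
  have : E (trunc n) k' s @[n --> \oo] --> E V k' s.
    have -> : E V k' s = (\int[P k']_w limn (fun n => (trunc n (X s w))%:E))%E.
      apply: eq_integral => w _; apply/esym/cvg_lim => //.
      apply/fine_cvgP; split; first exact: nearW.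
      apply: cvg_near_cst.
      have /cvgryPge/(_ (V (X s w))) := @cvgr_idn R.
      by apply: filterS => n Vn; rewrite /= /trunc min_l.
    apply: (@cvg_monotone_convergence _ _ _ (P k') setT measurableT
      (fun n w => (trunc n (X s w))%:E)).
    - by move=> n; exact: measurable_int_comp.
    - by move=> n w _; rewrite lee_fin.
    - move=> w _ m n mn; rewrite lee_fin /trunc le_min ge_min lexx /=.
      by rewrite ge_min ler_nat mn orbT.
  move=> EV; rewrite -(cvg_lim _ EV)//; apply: lime_le.
    by apply/cvg_ex; exists (E V k' s).
  by apply: nearW => n; exact: chain_mean_trunc_le.
apply/eqP; rewrite eq_le le_V//=.
have tt : 0 <= t <= t by rewrite t0 lexx.
apply: (@subsolution V V lam (expR (`|lam| * t)) t
  (fun k t => V k * expR (lam * t)) _ _ _ _ _ _ _ _ k t tt) => //.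
- by move=> k' s s0; apply: le_lt_trans (le_V _ _ s0) _; rewrite ltry.
- move=> k' s; apply: is_derive_eq; rewrite /GRing.scale /=.
  transitivity (expR (lam * s) * nbr_sum G k' V).
    by rewrite V_eigen; ring.
  by rewrite /nbr_sum; ring.
- by move=> k'; rewrite mulr0 expR0 mulr1.
- move=> k' s /andP[s0 st]; rewrite mulrC ler_wpM2r// ler_expR.
  apply: (@le_trans _ _ (`|lam| * s)).
    by rewrite ler_wpM2r// ler_norm.
  by rewrite ler_wpM2l.
Qed.

End perron_eigenfunction.

(** * Integrability and mean from the Laplace transform *)

Section mean_laplace.
Context {d} {T : measurableType d} {R : realType}.
Variables (P : probability T R) (Y : T -> R).
Hypothesis mY : measurable_fun setT Y.

Let m_exp (l b : R) : measurable_fun setT (EFin \o (fun w => expR (l * Y w + b))).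
Proof.
apply/measurable_EFinP; apply: measurableT_comp => //.
by apply: measurable_funD => //; exact: measurable_funM.
Qed.

Lemma integrable_exp_affine l b : (laplace P Y l < +oo)%E ->
  P.-integrable setT (EFin \o (fun w => expR (l * Y w + b))).
Proof.
move=> Yl; apply/integrableP; split; first exact: m_exp.
under eq_integral do rewrite /= ger0_norm ?expR_ge0//.
by rewrite integral_exp_affine// lte_mul_pinfty// ?lee_fin ?expR_ge0.
Qed.

(** [|Y|] is at most the sum of the exponentials of [l * Y] and [- l * Y] divided by [l]; the shift
    [- ln l] performs the division. *)
Lemma integrable_of_laplace l : 0 < l -> (laplace P Y l < +oo)%E ->
  (laplace P Y (- l) < +oo)%E -> P.-integrable setT (EFin \o Y).
Proof.
move=> l0 Yl YNl.
have il := integrable_exp_affine (- ln l) Yl.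
have iNl := integrable_exp_affine (- ln l) YNl.
apply: (le_integrable measurableT _ _ (integrableD measurableT il iNl)).
  exact/measurable_EFinP.
move=> w _; rewrite /= lee_fin [leRHS]ger0_norm ?addr_ge0 ?expR_ge0//.
rewrite !expRD expRN lnK// -mulrDl ler_pdivlMr//.
have := expR_ge1Dx (l * Y w); have := expR_ge1Dx (- l * Y w).
have := expR_ge0 (l * Y w); have := expR_ge0 (- l * Y w).
by have [Y0|Y0] := leP 0 (Y w); [rewrite ger0_norm|rewrite ltr0_norm]; nra.
Qed.

(** Integrate [1 + x <= e^x] at [x = l (Y - m)]. *)
Lemma mean_le_laplace l m : P.-integrable setT (EFin \o Y) ->
  ((1 + l * (fine ('E_P[Y]) - m))%:E <= (expR (- (l * m)))%:E * laplace P Y l)%E.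
Proof.
move=> iY.
have [YNy|] := ltP (laplace P Y l) +oo%E; last first.
  by rewrite leye_eq => /eqP ->; rewrite gt0_muley ?leey// lte_fin expR_gt0.
have iE := integrable_exp_affine (- (l * m)) YNy.
have ic : P.-integrable setT (EFin \o cst (1 - l * m)).
  exact: finite_measure_integrable_cst.
have ilY : P.-integrable setT (EFin \o (fun w => l * Y w)).
  exact: (integrableZl measurableT l iY).
rewrite -integral_exp_affine//.
have -> : (1 + l * (fine 'E_P[Y] - m))%:E =
  (\int[P]_w ((cst (1 - l * m) w)%:E + (l * Y w)%:E))%E.
  rewrite integralD_EFin// [X in (X + _)%E](_ : _ = (1 - l * m)%:E); last first.
    transitivity (\int[P]_w cst (1 - l * m)%:E w)%E; first by [].
    by rewrite integral_cst//= probability_setT mule1.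
  rewrite (_ : (\int[P]_x (l * Y x)%:E = l%:E * 'E_P[Y])%E); last first.
    by rewrite unlock -integralZl.
  rewrite -[in RHS](@fineK _ 'E_P[Y]); last first.
    by rewrite unlock; exact: integrable_fin_num.
  by rewrite -EFinM -EFinD; congr (_%:E); ring.
apply: le_integral => //; first exact: integrableD.
move=> w _; rewrite -EFinD lee_fin /=; apply: le_trans (expR_ge1Dx _).
by rewrite le_eqVlt; apply/orP; left; apply/eqP; ring.
Qed.

End mean_laplace.

(** * Laplace transform of the chain near the origin *)

Section alternating_laplace.
Context {R : realType} {d : measure_display} {Omega : measurableType d}.
Variables (alpha1 alpha2 beta1 beta2 : R).
Hypothesis alpha1_gt0 : 0 < alpha1.
Hypothesis alpha2_gt0 : 0 < alpha2.
Hypothesis beta1_gt0 : 0 < beta1.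
Hypothesis beta2_gt0 : 0 < beta2.
Variables (P : int -> probability Omega R) (X : R -> {mfun Omega >-> int}).
Hypothesis hX : is_markov_chain P X.
Local Notation G := (alternating_generator alpha1 alpha2 beta1 beta2).
Hypothesis hgen : has_generator P X G.
Local Notation a := (alpha1 + alpha2).
Local Notation b := (beta1 + beta2).
Local Notation L := (Lambda alpha1 alpha2 beta1 beta2).
Local Notation A := (tilted_even alpha1 alpha2).

(** Normalised to 1 on the even class; the odd component solves the even row [- a + A g * r = L g]
    of the eigenvalue equation. The odd row then follows from [Lambda_eigen]. *)
Definition perron_vector (g : R) k : R :=
  expR (g * k%:~R) * (if (2 %| k)%Z then 1 else (L g + a) / A g).

Lemma perron_vector_gt0 g k : 0 < perron_vector g k.
Proof.
rewrite mulr_gt0 ?expR_gt0//; case: ifP => // _.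
by rewrite divr_gt0 ?Lambda_add_even_gt0 ?tilted_even_gt0.
Qed.

Lemma perron_vector_eigen g k :
  nbr_sum G k (perron_vector g) = L g * perron_vector g k.
Proof.
rewrite nbr_sum_generator /perron_vector.
have -> : (k - 1)%:~R = k%:~R - 1 :> R by rewrite rmorphB.
have -> : (k + 1)%:~R = k%:~R + 1 :> R by rewrite rmorphD.
have A0 : A g != 0 by rewrite gt_eqF// tilted_even_gt0.
have La0 : L g + a != 0 by rewrite gt_eqF// Lambda_add_even_gt0.
rewrite mulrBr mulrDr mulr1 !expRD.
have [k2|k2] := boolP (2 %| k)%Z.
  have -> : (2 %| k - 1)%Z = false by lia.
  have -> : (2 %| k + 1)%Z = false by lia.
  have E : alpha2 * (L g + a) * expR (- g) + alpha1 * (L g + a) * expR g =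
      (L g + a) * A g by rewrite /tilted_even; ring.
  transitivity (expR (g * k%:~R) * ((alpha2 * (L g + a) * expR (- g) +
    alpha1 * (L g + a) * expR g) / A g - a)); first by field.
  by rewrite E; field.
have -> : (2 %| k - 1)%Z by lia.
have -> : (2 %| k + 1)%Z by lia.
have -> : L g * (expR (g * k%:~R) * ((L g + a) / A g)) =
  expR (g * k%:~R) * (((L g + a) * (L g + b)) / A g - b * (L g + a) / A g) by field.
rewrite Lambda_eigen// /tilted_odd; field.
exact: A0.
Qed.

(** The eigenfunction is within a factor 2 of [e^(g k)]. This is used once at the starting point and
    once at [X t], whence the 4, uniformly in [k] and [t]. *)
Lemma laplace_bounds : \forall g \near (0 : R), forall k t, 0 <= t ->
  ((4^-1 * expR (g * k%:~R + t * L g))%:E <=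
     laplace (P k) (fun w => (X t w)%:~R) g <=
   (4 * expR (g * k%:~R + t * L g))%:E)%E.
Proof.
have := perron_ratio_near alpha1_gt0 alpha2_gt0 beta1_gt0 beta2_gt0.
apply: filterS => g /andP[r1 r2] k t t0.
set V := perron_vector g.
have EV := chain_mean_eigen alpha1_gt0 alpha2_gt0 beta1_gt0 beta2_gt0 hX hgen
  (perron_vector_gt0 g) (perron_vector_eigen g) k t0.
pose f (x : int) : R := expR (g * x%:~R).
have f0 x : 0 <= f x by exact: expR_ge0.
have V0 x : 0 <= V x by exact: ltW (perron_vector_gt0 g x).
have rV x : 2^-1 * f x <= V x <= 2 * f x.
  rewrite /V /perron_vector /f; have := expR_gt0 (g * x%:~R).
  by case: (2 %| x)%Z; nra.
have -> : laplace (P k) (fun w => (X t w)%:~R) g = chain_mean P X f k t by [].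
have /andP[k1 k2] := rV k.
rewrite expRD [t * _]mulrC -/(f k).
have e0 := expR_gt0 (L g * t).
apply/andP; split.
  have : (chain_mean P X V k t <= 2%:E * chain_mean P X f k t)%E.
    rewrite -chain_meanZ//; apply: chain_mean_le => // x; by case/andP: (rV x).
  rewrite EV -lee_pdivrMl// -EFinM; apply: le_trans; rewrite lee_fin.
  have := ler_wpM2r (ltW e0) k1; rewrite /V; lra.
have : (2^-1%:E * chain_mean P X f k t <= chain_mean P X V k t)%E.
  by rewrite -chain_meanZ//; apply: chain_mean_le => // x; [rewrite mulr_ge0|case/andP: (rV x)].
rewrite EV -lee_pdivlMl// => /le_trans; apply; rewrite -EFinM lee_fin invrK.
have := ler_wpM2r (ltW e0) k2; rewrite /V; lra.
Qed.

End alternating_laplace.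

(** * Moderate deviations *)

Section moderate_deviations.
Context {R : realType} {d : measure_display} {Omega : measurableType d}.
Variables (alpha1 alpha2 beta1 beta2 : R).
Hypothesis alpha1_gt0 : 0 < alpha1.
Hypothesis alpha2_gt0 : 0 < alpha2.
Hypothesis beta1_gt0 : 0 < beta1.
Hypothesis beta2_gt0 : 0 < beta2.
Variables (P : int -> probability Omega R) (X : R -> {mfun Omega >-> int}).
Hypothesis hX : is_markov_chain P X.
Local Notation G := (alternating_generator alpha1 alpha2 beta1 beta2).
Hypothesis hgen : has_generator P X G.
Local Notation L := (Lambda alpha1 alpha2 beta1 beta2).
Let L1 : R := (L^`() 0)%classic.
Let L2 : R := (L^`(2))%classic 0.

Let Xr t (w : Omega) : R := (X t w)%:~R.

Let mXr t : measurable_fun setT (Xr t).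
Proof. by apply/measurable_EFinP; exact: (measurable_int_comp (X t) (fun x => x%:~R)). Qed.

Let L2_gt0 : 0 < L2.
Proof. exact: derive2_Lambda0_gt0. Qed.

(** At tilts of size [1 / sqrt t] the quadratic term of [t * L g] is of order 1, so both signs of
    the tilt bound the deviation of the mean by a multiple of [sqrt t]. *)
Lemma state_mean_asymp k : exists2 C, 0 <= C &
  \forall t \near +oo, `|state_mean P X k t - k%:~R - L1 * t| <= C * Num.sqrt t.
Proof.
have := laplace_bounds alpha1_gt0 alpha2_gt0 beta1_gt0 beta2_gt0 hX hgen.
move=> /nbhs_ballP[d1 /= d10 H1].
have := Lambda_taylor alpha1_gt0 alpha2_gt0 beta1_gt0 beta2_gt0 ltr01.
move=> /nbhs_ballP[d2 d2_gt0 H2]; have d20 : 0 < d2 := d2_gt0.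
(* The 4 comes from [laplace_bounds]; since [t * g ^+ 2 = 1], the exponent is the quadratic term
   plus the Taylor error. *)
pose C := 4 * expR (1 + L2 / 2).
have C0 : 0 <= C by rewrite mulr_ge0// expR_ge0.
exists C => //; near=> t.
have t0 : 0 < t by near: t; exact: nbhs_pinfty_gt.
have tD : (Num.min d1 d2)^-1 ^+ 2 < t.
  by near: t; apply: nbhs_pinfty_gt; exact: num_real.
have D0 : 0 < Num.min d1 d2 by rewrite lt_min d10.
set m := state_mean P X k t.
set x := k%:~R + L1 * t.
have s0 : 0 < Num.sqrt t by rewrite sqrtr_gt0.
pose r := (Num.sqrt t)^-1.
have r0 : 0 < r by rewrite invr_gt0.
have rD : r < Num.min d1 d2.
  rewrite invf_plt ?posrE//.
  have i0 : 0 < (Num.min d1 d2)^-1 by rewrite invr_gt0.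
  by rewrite -(gtr0_norm i0) -sqrtr_sqr ltr_sqrt.
have r2 : t * r ^+ 2 = 1.
  by rewrite exprVn sqr_sqrtr ?divff ?gt_eqF// ltW.
have small g : `|g| = r -> (laplace (P k) (Xr t) g <=
    (expR (g * x) * C)%:E)%E.
  move=> gr; have gb e : Num.min d1 d2 <= e -> ball (0 : R) e g.
    by move=> ?; rewrite /ball /= sub0r normrN gr (lt_le_trans rD).
  have /H1/(_ k t (ltW t0))/andP[_ /le_trans] : ball (0 : R) d1 g.
    by apply: gb; rewrite ge_min lexx.
  apply; rewrite lee_fin /C mulrCA ler_pM2l// -expRD ler_expR /x.
  have /H2 : ball (0 : R) d2 g by apply: gb; rewrite ge_min lexx orbT.
  rewrite -/L1 -/L2 mul1r => /ler_normlW.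
  have gg : t * g ^+ 2 = 1 by rewrite -r2 -gr -normrX ger0_norm ?sqr_ge0.
  move=> /(ler_wpM2l (ltW t0)).
  rewrite [t * g ^+ 2]gg => Hg.
  have : t * (L g - L1 * g - L2 / 2 * g ^+ 2) =
    t * L g - t * L1 * g - L2 / 2 * (t * g ^+ 2) by ring.
  rewrite gg; lra.
have iX : (P k).-integrable setT (EFin \o Xr t).
  apply: (integrable_of_laplace (mXr t) r0).
    by apply: le_lt_trans (small _ (gtr0_norm r0)) _; rewrite ltry.
  by apply: le_lt_trans (small _ _) _; rewrite ?ltry// normrN gtr0_norm.
have bnd g : `|g| = r -> 1 + g * (m - x) <= C.
  move=> gr; rewrite -lee_fin; apply: le_trans (mean_le_laplace (mXr t) g x iX) _.
  apply: le_trans (lee_wpmul2l _ (small _ gr)) _; first by rewrite lee_fin expR_ge0.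
  by rewrite -EFinM lee_fin mulrA -expRD addNr expR0 mul1r.
rewrite -addrA -opprD -/x.
have B1 := bnd _ (gtr0_norm r0).
have B2 : 1 + - r * (m - x) <= C by apply: bnd; rewrite normrN gtr0_norm.
have : `|r * (m - x)| <= C by rewrite ler_norml; apply/andP; split; lra.
by rewrite normrM gtr0_norm// /r ler_pdivrMl// mulrC.
Unshelve. all: by end_near. Qed.

Variable a : R -> R.
Hypothesis a_gt0 : forall t, 0 < t -> 0 < a t.
Hypothesis a_cvg0 : a t @[t --> +oo] --> 0.
Hypothesis ta_cvgy : t * a t @[t --> +oo] --> +oo.

Lemma speed_cvgy : 1 / a t @[t --> +oo] --> +oo.
Proof.
apply/cvgryPge => M.
have M1 : 0 < `|M| + 1 by rewrite ltr_wpDl.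
near=> t.
have t0 : 0 < t by near: t; exact: nbhs_pinfty_gt.
have at0 := a_gt0 t0.
apply: (@le_trans _ _ (`|M| + 1)).
  by apply: le_trans (ler_norm M) _; rewrite lerDl.
rewrite ler_pdivlMr// mulrC -ler_pdivlMr//; near: t.
by apply: (cvgr_le _ a_cvg0); rewrite divr_gt0.
Unshelve. all: by end_near. Qed.

Lemma sqrt_ta_ge (M : R) : \forall t \near +oo, M <= Num.sqrt (t * a t).
Proof.
have /cvgryPge/(_ (M ^+ 2)) := ta_cvgy; apply: filterS => t Mt.
by rewrite (le_trans (ler_norm M))// -sqrtr_sqr ler_wsqrtr.
Qed.

Let Y k t w : R := fluctuation P X a k t w.

Let mY k t : measurable_fun setT (Y k t).
Proof.
apply/measurable_EFinP.
exact: (measurable_int_comp (X t)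
  (fun x => Num.sqrt (t * a t) * ((x%:~R - state_mean P X k t) / t))).
Qed.

(** The transform at [l / a t] is that of the centred [X t] at [g = l / sqrt (t * a t)], which tends
    to 0, and [t * g ^+ 2 = l ^+ 2 / a t]. The factor 4, the error in the mean and the Taylor
    remainder each take a third of [e]. *)
Lemma fluctuation_laplace k l e : 0 < e -> \forall t \near +oo,
  ((expR (1 / a t * (L2 * l ^+ 2 / 2 - e)))%:E <=
     laplace (P k) (Y k t) (1 / a t * l)
   <= (expR (1 / a t * (L2 * l ^+ 2 / 2 + e)))%:E)%E.
Proof.
move=> e0.
have e3 : 0 < e / 3 by rewrite divr_gt0.
have := laplace_bounds alpha1_gt0 alpha2_gt0 beta1_gt0 beta2_gt0 hX hgen.
move=> /nbhs_ballP[d1 /= d10 H1].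
have l1 : 0 < l ^+ 2 + 1 by rewrite ltr_wpDl ?sqr_ge0.
(* The Taylor error is later multiplied by [l ^+ 2 / a t]; the added 1 covers [l = 0]. *)
have e'0 : 0 < e / 3 / (l ^+ 2 + 1) by rewrite divr_gt0.
have := Lambda_taylor alpha1_gt0 alpha2_gt0 beta1_gt0 beta2_gt0 e'0.
move=> /nbhs_ballP[d2 d2_gt0 H2]; have d20 : 0 < d2 := d2_gt0.
have [C C0 HC] := state_mean_asymp k.
near=> t.
have t0 : 0 < t by near: t; exact: nbhs_pinfty_gt.
have at0 := a_gt0 t0.
have ta0 : 0 < t * a t by rewrite mulr_gt0.
have sd1 : (`|l| + 1) / d1 <= Num.sqrt (t * a t) by near: t; exact: sqrt_ta_ge.
have sd2 : (`|l| + 1) / d2 <= Num.sqrt (t * a t) by near: t; exact: sqrt_ta_ge.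
have ml : `|state_mean P X k t - k%:~R - L1 * t| <= C * Num.sqrt t by near: t.
have four : 4 <= expR (1 / a t * (e / 3)).
  by near: t; apply: near_expR_speed_ge => //; exact: speed_cvgy.
(* The error in the mean contributes [|l| C] times the square root of the speed, negligible against
   the speed. *)
have vC : (`|l| * C / (e / 3)) ^+ 2 <= 1 / a t.
  by near: t; have /cvgryPge := speed_cvgy; exact.
set s := Num.sqrt (t * a t).
have s0 : 0 < s by rewrite sqrtr_gt0.
have s2 : s ^+ 2 = t * a t by rewrite sqr_sqrtr// ltW.
pose g := l / s.
set m := state_mean P X k t.
have gsmall D : 0 < D -> (`|l| + 1) / D <= s -> ball (0 : R) D g.
  move=> D0; rewrite ler_pdivrMr// => lD.
  rewrite /ball /= sub0r normrN /g normrM normfV (gtr0_norm s0) ltr_pdivrMr// mulrC.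
  by apply: lt_le_trans lD; rewrite ltrDl.
have /H1/(_ k t (ltW t0))/andP[lb ub] : ball (0 : R) d1 g.
  exact: gsmall.
have /H2 taylor : ball (0 : R) d2 g.
  exact: gsmall.
have YE : laplace (P k) (Y k t) (1 / a t * l) =
    ((expR (- (g * m)))%:E * laplace (P k) (Xr t) g)%E.
  rewrite -integral_exp_affine//; apply: eq_integral => w _.
  rewrite /Y /fluctuation -/s -/m; congr (expR _)%:E.
  have -> : (a t)^-1 = t / s ^+ 2 by rewrite s2; field; rewrite !gt_eqF.
  by rewrite /g /Xr; field; rewrite !gt_eqF.
set v := 1 / a t.
have v0 : 0 < v by rewrite divr_gt0.
have tg2 : t * g ^+ 2 = l ^+ 2 * v.
  by rewrite /g expr_div_n s2 /v; field; rewrite !gt_eqF.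
have mean_small : `|g * (m - k%:~R - L1 * t)| <= v * (e / 3).
  rewrite normrM; apply: le_trans (ler_wpM2l (normr_ge0 _) ml) _.
  pose u := Num.sqrt v.
  have u2 : u ^+ 2 = v by rewrite sqr_sqrtr// ltW.
  have u0 : 0 < u by rewrite sqrtr_gt0.
  have -> : `|g| * (C * Num.sqrt t) = `|l| * C * u.
    have -> : Num.sqrt t = s * u.
      by rewrite /s /u -sqrtrM ?(ltW ta0)// /v; congr Num.sqrt; field; rewrite gt_eqF.
    by rewrite /g normrM normfV (gtr0_norm s0); field; rewrite gt_eqF.
  have uC : `|l| * C / (e / 3) <= u.
    by rewrite (le_trans (ler_norm _))// -sqrtr_sqr ler_wsqrtr.
  move: uC; rewrite ler_pdivrMr// => /(ler_wpM2r (ltW u0)).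
  have -> : u * (e / 3) * u = u ^+ 2 * (e / 3) by ring.
  by rewrite u2.
have taylor_small : `|t * L g - t * L1 * g - L2 / 2 * (l ^+ 2 * v)| <= v * (e / 3).
  have -> : t * L g - t * L1 * g - L2 / 2 * (l ^+ 2 * v) =
    t * (L g - L1 * g - L2 / 2 * g ^+ 2) by rewrite -tg2; ring.
  rewrite normrM (gtr0_norm t0); apply: le_trans (ler_wpM2l (ltW t0) taylor) _.
  rewrite mulrCA tg2 mulrA [leRHS]mulrC ler_wpM2r// ?(ltW v0)//.
  by rewrite mulrAC ler_pdivrMr// ler_wpM2l ?(ltW e3)// lerDl.
move: mean_small taylor_small; rewrite !ler_norml => /andP[M1 M2] /andP[T1 T2].
have expo : - (g * m) + (g * k%:~R + t * L g) =
  (t * L g - t * L1 * g - L2 / 2 * (l ^+ 2 * v)) - g * (m - k%:~R - L1 * t) +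
  v * (L2 * l ^+ 2 / 2) by field.
rewrite YE; apply/andP; split.
  apply: le_trans (lee_wpmul2l _ lb); last by rewrite lee_fin expR_ge0.
  rewrite -EFinM lee_fin [leRHS]mulrCA -expRD expo ler_pdivlMl//.
  apply: le_trans (ler_wpM2r (expR_ge0 _) four) _.
  rewrite -expRD ler_expR -/v; lra.
apply: le_trans (lee_wpmul2l _ ub) _; first by rewrite lee_fin expR_ge0.
rewrite -EFinM lee_fin [leLHS]mulrCA -expRD expo.
apply: le_trans (ler_wpM2r (expR_ge0 _) four) _.
rewrite -expRD ler_expR -/v; lra.
Unshelve. all: by end_near. Qed.

Lemma measurable_fluctuation_preimage k t (B : set R) : measurable (Y k t @^-1` B).
Proof.
exact: (measurable_preimage_int (X t) ((fun x : int =>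
  Num.sqrt (t * a t) * ((x%:~R - state_mean P X k t) / t)) @^-1` B)).
Qed.

Lemma fluctuation_LDP k :
  satisfies_LDP (fun t : R => distribution (P k) (fluctuation P X a k t))
    (fun t : R => 1 / a t) (J alpha1 alpha2 beta1 beta2).
Proof.
split.
- exact: speed_cvgy.
- by move=> y; rewrite lee_fin divr_ge0 ?sqr_ge0// mulr_ge0// ltW.
- move=> y x; rewrite /J lte_fin -/L2 => xy.
  exists [set z : R | x < z ^+ 2 / (2 * L2)]; last by move=> z /=; rewrite lte_fin.
  have cy : z ^+ 2 / (2 * L2) @[z --> y] --> y ^+ 2 / (2 * L2).
    by apply: cvgMl; exact: exprn_continuous.
  exact: (cvgr_gt _ cy).
- move=> O oO; apply: (gartner_ellis_liminf (mY k) L2_gt0 speed_cvgy _ oO).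
    by move=> l e; exact: fluctuation_laplace.
  by move=> t; exact: measurable_fluctuation_preimage.
- move=> C _; apply: (gartner_ellis_limsup (mY k) L2_gt0 speed_cvgy).
    by move=> l e; exact: fluctuation_laplace.
  by move=> t; exact: measurable_fluctuation_preimage.
Qed.

Lemma good_rate_function_J : good_rate_function (J alpha1 alpha2 beta1 beta2).
Proof.
move=> eta eta0.
pose r := Num.sqrt (2 * L2 * eta).
have L20 : 0 < 2 * L2 by rewrite mulr_gt0.
rewrite (_ : [set y | _] = `[- r, r]%classic); first exact: segment_compact.
apply/seteqP; split => y /=; rewrite /J lee_fin -/L2 ler_pdivrMr// in_itv /= -ler_norml mulrC.
  by move=> yr; rewrite -sqrtr_sqr ler_wsqrtr.
move=> yr; have r2 : r ^+ 2 = 2 * L2 * eta by rewrite sqr_sqrtr// mulr_ge0// ltW.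
by rewrite -r2 -real_normK ?num_real// lerXn2r// nnegrE sqrtr_ge0.
Qed.

End moderate_deviations.

Unset Implicit Arguments.

Theorem proposition3p4 (R : realType) (alpha1 alpha2 beta1 beta2 : R)
  (halpha1 : 0 < alpha1) (halpha2 : 0 < alpha2)
  (hbeta1 : 0 < beta1) (hbeta2 : 0 < beta2)
  (d : measure_display) (Omega : measurableType d)
  (P : int -> probability Omega R) (X : R -> {mfun Omega >-> int})
  (hX : is_markov_chain P X)
  (hgen : has_generator P X (alternating_generator alpha1 alpha2 beta1 beta2))
  (a : R -> R) (a_gt0 : forall t : R, 0 < t -> 0 < a t)
  (a_cvg0 : a t @[t --> +oo] --> 0)
  (ta_cvgy : t * a t @[t --> +oo] --> +oo)
  (k : int) :
  satisfies_LDP (fun t : R => distribution (P k) (fluctuation P X a k t))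
    (fun t : R => 1 / a t) (J alpha1 alpha2 beta1 beta2)
  /\ good_rate_function (J alpha1 alpha2 beta1 beta2).
Proof.
split; first exact: fluctuation_LDP.
exact: good_rate_function_J.
Qed.
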